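(* Let $N\ge 3$, let $w_1,\dots,w_r\in\mathbb{R}^N$ be pairwise distinct points not contained in any real affine plane, and let $F(x)=\prod_{j=1}^r|x-w_j|^2$. Assume that $F$ is a local Morse function on $\mathbb{R}^N$, i.e. every critical point of $F$ has nondegenerate Hessian. Then $F$ has finitely many critical points: its $r$ absolute minima $w_1,\dots,w_r$, some number $h\ge 0$ of local minima in $\mathbb{R}^N\setminus\{w_1,\dots,w_r\}$, and exactly $r+h-1$ further critical points, each of negativity index $1$; there are no other critical points.
   Context: $|\cdot|$ is the Euclidean norm. The negativity index of a nondegenerate critical point is the number of negative eigenvalues of the Hessian there. *)

(* Defs.v *)
From Stdlib Require Import Reals ClassicalEpsilon.
From mathcomp Require Import all_boot.

Set Implicit Arguments.
Unset Strict Implicit.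

Local Open Scope R_scope.

Definition vec (N : nat) := 'I_N -> R.

Definition vsub N (x y : vec N) : vec N := fun i => x i - y i.
Definition vadd N (x y : vec N) : vec N := fun i => x i + y i.
Definition vscale N (a : R) (x : vec N) : vec N := fun i => a * x i.

Definition dot N (x y : vec N) : R := \big[Rplus/0]_(i < N) (x i * y i).

Definition enorm N (x : vec N) : R := sqrt (dot x x).

Definition Fprod N r (w : 'I_r -> vec N) (x : vec N) : R :=
  \big[Rmult/1]_(j < r) (enorm (vsub x (w j)) ^ 2).

Definition in_affine_plane N r (w : 'I_r -> vec N) : Prop :=
  exists p u v : vec N, forall j, exists s t : R,
    w j = vadd p (vadd (vscale s u) (vscale t v)).

Definition shift N (x : vec N) (k : 'I_N) (t : R) : vec N :=
  fun i => if i == k then x i + t else x i.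

Definition is_partial N (f : vec N -> R) (x : vec N) (k : 'I_N) (l : R) : Prop :=
  derivable_pt_lim (fun t => f (shift x k t)) 0 l.

(* the k-th partial derivative (chosen by epsilon; meaningful when it exists) *)
Definition partial N (f : vec N -> R) (k : 'I_N) (x : vec N) : R :=
  epsilon (inhabits 0) (fun l => is_partial f x k l).

Definition is_critical N (f : vec N -> R) (x : vec N) : Prop :=
  forall k, is_partial f x k 0.

Definition hessian N (f : vec N -> R) (x : vec N) : 'I_N -> 'I_N -> R :=
  fun k l => partial (partial f k) l x.

Definition matvec N (H : 'I_N -> 'I_N -> R) (v : vec N) : vec N :=
  fun k => \big[Rplus/0]_(l < N) (H k l * v l).

Definition zero_vec N : vec N := fun _ => 0.

Definition nondegenerate N (H : 'I_N -> 'I_N -> R) : Prop :=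
  forall v : vec N, matvec H v = @zero_vec N -> v = @zero_vec N.

Definition Rltb (a b : R) : bool := if Rlt_dec a b then true else false.

(* Number of negative eigenvalues (with multiplicity) of a real symmetric
   matrix H equals m: read off an orthonormal eigenbasis (spectral theorem). *)
Definition neg_index N (H : 'I_N -> 'I_N -> R) (m : nat) : Prop :=
  exists (u : 'I_N -> vec N) (lam : 'I_N -> R),
    (forall i j, dot (u i) (u j) = if i == j then 1 else 0) /\
    (forall i, matvec H (u i) = vscale (lam i) (u i)) /\
    #|[pred i | Rltb (lam i) 0]| = m.

Definition local_min N (f : vec N -> R) (x : vec N) : Prop :=
  exists eps, 0 < eps /\ forall y, enorm (vsub y x) < eps -> f x <= f y.

Definition abs_min N (f : vec N -> R) (x : vec N) : Prop :=
  forall y, f x <= f y.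

Definition local_morse N (f : vec N -> R) : Prop :=
  forall x, is_critical f x -> nondegenerate (hessian f x).

(* Main.v *)
(* At a critical point x off the w_j, the trace of the Hessian of log F on a
   2-plane is a sum of terms that are nonnegative by Bessel's inequality, the
   j-th one vanishing only if w_j lies in the plane through x.  As the w_j are
   not coplanar, two eigenvalues of the Hessian have a positive sum, so the
   negativity index is 0 or 1; the relation between the numbers of critical
   points is then sum (-1)^index = 1, i.e. the degree of G = grad F is 1.

   The degree is measured by averaging the density phi(rho - |G|^2) det DG,
   phi(q) = max(q, 0)^2, over finer and finer lattices.  Along a polynomial
   homotopy this density is the time component of a divergence-free field, the
   remaining components being the other maximal minors of the space-time
   Jacobian; sums of forward differences telescope, so the average changes by
   O(1/M) as long as |G|^2 >= rho near the boundary.  Near a critical point a,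
   G is homotopic to A(x - a), where A has the eigenvectors of the Hessian and the
   signs of its eigenvalues, and on a large ball G is homotopic to x. *)

Require Import Defs.
From Stdlib Require Import Reals ClassicalEpsilon FunctionalExtensionality.
From Stdlib Require List.
From mathcomp Require Import all_boot all_order all_algebra all_fingroup.
From mathcomp Require Import mpoly Rstruct ring lra.

Set Implicit Arguments.
Unset Strict Implicit.
Unset Printing Implicit Defensive.

Import Order.TTheory GRing.Theory Num.Theory.
Local Open Scope ring_scope.

(** * Divergence-free minors *)

(** Two properties of phi decide its choice. It vanishes for q <= 0, so where |G|^2 >= rho near the
    boundary of a ball the density can be cut off abruptly without a jump. And it is differentiable
    with a quadratic Taylor remainder: remainders of size M^-2 at the M^(n+1) nodes of a space-time
    lattice add up to O(M^(n-1)), small against the M^n nodes in space.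

    One density is evaluated twice. On the large ball its sum is close to the sum W(M) of a standard
    bump. Since it vanishes away from the zeros of G, it is also a sum over small balls around them,
    each close to det A W(M), where det A = (-1)^index. So (sum of det A - 1) W(M) = O(M^(n-1)),
    whereas W(M) is at least a constant times M^n for suitable M, and the first factor must be 0.

    A is taken orthogonal, not as the Hessian itself, because |A(x - a)|^2 is then the plain squared
    distance and all linear models share one bump. The points w_j enter the count with index 0,
    their Hessians being positive definite. *)

Section NullLagrangian.
Variables (K : realFieldType) (n : nat).
Implicit Types G : 'I_n -> {mpoly K[n.+1]}.

Lemma mderiv_prod (I : finType) (P : pred I) (F : I -> {mpoly K[n.+1]}) j :
  (\prod_(i | P i) F i)^`M(j) =
  \sum_(i | P i) (F i)^`M(j) * \prod_(l | P l && (l != i)) F l.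
Proof.
have H (s : seq I) : uniq s ->
  (\prod_(i <- s | P i) F i)^`M(j) =
  \sum_(i <- s | P i) (F i)^`M(j) * \prod_(l <- s | P l && (l != i)) F l.
  elim: s => [_|x s IH /= /andP[xs us]].
    by rewrite !big_nil -[1]/(1%:MP) mderivC.
  rewrite !big_cons; case: ifP => Px; last first.
    rewrite IH //; apply: eq_bigr => i Pi; rewrite big_cons Px //.
  rewrite mderivM IH // eqxx andbF /=; congr (_ * _ + _).
    rewrite big_seq_cond [RHS]big_seq_cond; apply: eq_bigl => i.
    by case: (eqVneq i x) => [->|]; rewrite ?(negbTE xs) ?andbT ?andbF.
  rewrite big_distrr /= big_seq_cond [RHS]big_seq_cond.
  apply: eq_bigr => i /andP[si Pi].
  rewrite big_cons Px /=; case: eqVneq => [xi|_]; last by rewrite mulrCA.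
  by rewrite xi si in xs.
exact: H (index_enum_uniq I).
Qed.

(** A zero row 0 makes the matrix square, so that the signed maximal minors of the n x (n+1)
    space-time Jacobian are its cofactors along that row. *)
Definition jacobian G : 'M[{mpoly K[n.+1]}]_n.+1 :=
  \matrix_(i, j) if unlift ord0 i is Some i' then (G i')^`M(j) else 0.

Lemma jacobian_deriv_sym G k j l :
  (jacobian G k j)^`M(l) = (jacobian G k l)^`M(j).
Proof.
rewrite !mxE; case: unliftP => [i _|_]; first exact: mderiv_comm.
by rewrite !mderiv0.
Qed.

(** Piola's identity: the minors are the coefficients of the closed form dG_1 ^ ... ^ dG_n. *)
Lemma divergence_cofactor G :
  \sum_j (cofactor (jacobian G) ord0 j)^`M(j) = 0.
Proof.
set J := jacobian G.
transitivity (\sum_(k | ord0 != k) \sum_(s : 'S_n.+1)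
   (-1) ^+ s * ((J k (s k))^`M(s ord0) *
     \prod_(l | (ord0 != l) && (l != k)) J l (s l))).
  rewrite exchange_big /= [RHS](partition_big (fun s : 'S_n.+1 => s ord0) predT) //=.
  apply: eq_bigr => j _; rewrite expand_cofactor raddf_sum /=.
  apply: eq_bigr => s /eqP sj; rewrite -mulr_sumr sj -mderiv_prod.
  by rewrite !mulr_sign; case: (odd_perm s); rewrite ?mderivN.
(* Swapping rows [0] and [k] changes the sign of a term and, second derivatives
   being symmetric, nothing else. *)
apply: big1 => k k0; set T := \sum_s _.
suff TN : T = - T.
  have -> : T = 2^-1 *: (T *+ 2).
    by rewrite -scaler_nat scalerA mulVf ?pnatr_eq0 // scale1r.
  by rewrite (mulr2n T) {1}TN addNr scaler0.
rewrite {1}/T (reindex_inj (mulgI (tperm ord0 k))) /= -sumrN.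
apply: eq_bigr => s _; rewrite !permM tpermL tpermR odd_permM odd_tperm k0.
rewrite addTb signrN mulNr jacobian_deriv_sym; congr (- (_ * (_ * _))).
by apply: eq_bigr => l /andP[l0 lk]; rewrite permM tpermD // eq_sym.
Qed.

(** Putting the gradient of [G i] into row 0 produces two equal rows. This kills the part of the
    divergence in which the bump, a function of [G] alone, is differentiated. *)
Lemma cofactor_row_jacobian G i :
  \sum_j cofactor (jacobian G) ord0 j * (G i)^`M(j) = 0.
Proof.
pose A := \matrix_(a, b) if a == ord0 then (G i)^`M(b) else jacobian G a b.
have A0 : \det A = 0.
  apply: (determinant_alternate (neq_lift ord0 i)) => b.
  by rewrite !mxE eqxx /= liftK.
rewrite -[RHS]A0 [RHS](expand_det_row _ ord0); apply: eq_bigr => j _.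
rewrite mulrC mxE eqxx; congr (_ * (_ * \det _)).
by apply/matrixP => a b; rewrite !mxE.
Qed.

Lemma cofactor_jacobian0 G :
  cofactor (jacobian G) ord0 ord0 =
  \det (\matrix_(i, j) (G i)^`M(lift ord0 j)).
Proof.
rewrite /cofactor expr0 mul1r; congr (\det _).
by apply/matrixP => a b; rewrite !mxE liftK.
Qed.

End NullLagrangian.

(** * Taylor bounds *)

Section TaylorBounds.
Variables (K : realFieldType) (m : nat).
Implicit Types (p q : {mpoly K[m]}) (v z : 'I_m -> K) (L : K).

Lemma mpoly_ring_ind (P : {mpoly K[m]} -> Prop) :
  (forall c, P c%:MP) -> (forall i, P 'X_i) ->
  (forall p q, P p -> P q -> P (p + q)) ->
  (forall p q, P p -> P q -> P (p * q)) -> forall p, P p.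
Proof.
move=> PC PX PD PM; elim/mpolyind => [|c e p _ _ Pp]; first by rewrite -mpolyC0.
apply: PD => //; rewrite -mul_mpolyC; apply: (PM) => //; rewrite mpolyXE_id.
apply: (big_ind P) => [||i _]; [exact: (PC 1)|exact: PM|].
by elim: (e i) => [|d IH]; rewrite ?expr0 ?exprS; [exact: (PC 1)|exact: PM].
Qed.

Lemma mderivXU i j : ('X_j : {mpoly K[m]})^`M(i) = (i == j)%:R.
Proof.
rewrite mderivX mnm1E eq_sym; case: eqVneq => [->|_]; last by rewrite scale0r.
suff -> : (U_(j) - U_(j))%MM = 0%MM :> 'X_{1..m} by rewrite scale1r mpolyX0.
by apply/mnmP => k; rewrite mnmBE subnn mnm0E.
Qed.

Lemma meval_bounded p L :
  exists2 C, 0 <= C & forall v, (forall i, `|v i| <= L) -> `|p.@[v]| <= C.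
Proof.
elim/mpoly_ring_ind: p => [c|i|p q [C C0 HC] [D D0 HD]|p q [C C0 HC] [D D0 HD]].
- by exists `|c| => // v _; rewrite mevalC.
- exists `|L| => // v vL; rewrite mevalXU; apply: (le_trans (vL i)); exact: ler_norm.
- exists (C + D) => [|v vL]; first exact: addr_ge0.
  by rewrite mevalD; apply: (le_trans (ler_normD _ _)); rewrite lerD ?HC ?HD.
- exists (C * D) => [|v vL]; first exact: mulr_ge0.
  by rewrite mevalM normrM ler_pM ?HC ?HD.
Qed.

(** Only the base point [v] has to lie in the box: the remainder is 0 for constants and variables,
    and the product case needs bounds on values and first derivatives at [v] alone. The restriction
    s <= 1 absorbs higher powers of [s]. *)
Lemma meval_taylor p L :
  exists2 C, 0 <= C & forall v z s, (forall i, `|v i| <= L) ->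
    (forall i, `|z i| <= s) -> 0 <= s <= 1 ->
    `|p.@[fun i => v i + z i] - p.@[v] - \sum_i z i * p^`M(i).@[v]|
      <= C * s ^+ 2.
Proof.
elim/mpoly_ring_ind: p => [c|j|p q [C C0 HC] [D D0 HD]|p q [C C0 HC] [D D0 HD]].
- exists 0 => // v z s _ _ _; rewrite !mevalC subrr sub0r big1 ?oppr0 ?normr0 ?mul0r //.
  by move=> i _; rewrite mderivC meval0 mulr0.
- exists 0 => // v z s _ _ _; rewrite !mevalXU (bigD1 j) //= big1 => [|i ij].
    rewrite mderivXU eqxx meval1 mulr1 addr0.
    by rewrite (addrC (v j)) addrK subrr normr0 mul0r.
  by rewrite mderivXU (negbTE ij) meval0 mulr0.
- exists (C + D) => [|v z s vL zs s01]; first exact: addr_ge0.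
  have -> : \sum_i z i * (p + q)^`M(i).@[v] =
     \sum_i z i * p^`M(i).@[v] + \sum_i z i * q^`M(i).@[v].
    by rewrite -big_split; apply: eq_bigr => i _; rewrite mderivD mevalD mulrDr.
  rewrite !mevalD mulrDl; move: (HC v z s vL zs s01) (HD v z s vL zs s01).
  set a := p.@[_]; set b := q.@[_] => h1 h2.
  apply: le_trans (lerD h1 h2); apply: le_trans (ler_normD _ _).
  rewrite le_eqVlt; apply/orP; left; apply/eqP; congr `|_|; ring.
- have [Bp Bp0 HBp] := meval_bounded p L.
  have [Bq Bq0 HBq] := meval_bounded q L.
  have [E E0 HE] : exists2 E, 0 <= E & forall v z s, (forall i, `|v i| <= L) ->
     (forall i, `|z i| <= s) -> 0 <= s ->
     `|\sum_i z i * p^`M(i).@[v]| <= E * s /\ `|\sum_i z i * q^`M(i).@[v]| <= E * s.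
    have H r : exists2 E, 0 <= E & forall v z s, (forall i, `|v i| <= L) ->
       (forall i, `|z i| <= s) -> 0 <= s -> `|\sum_i z i * r^`M(i).@[v]| <= E * s.
      have [b Hb] : exists b : 'I_m -> K, forall i, 0 <= b i /\ forall v,
         (forall i, `|v i| <= L) -> `|r^`M(i).@[v]| <= b i.
        apply: (fin_all_exists (P := fun i b => 0 <= b /\ forall v,
         (forall i, `|v i| <= L) -> `|r^`M(i).@[v]| <= b)) => i.
        by have [b b0 hb] := meval_bounded r^`M(i) L; exists b.
      exists (\sum_i b i) => [|v z s vL zs s0].
        by apply: sumr_ge0 => i _; case: (Hb i).
      apply: (le_trans (ler_norm_sum _ _ _)); rewrite mulr_suml; apply: ler_sum.
      move=> i _; rewrite normrM mulrC; apply: ler_pM => //; by case: (Hb i) => _; apply.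
    have [E1 E10 H1] := H p; have [E2 E20 H2] := H q; exists (E1 + E2) => [|v z s vL zs s0].
      exact: addr_ge0.
    have := H1 v z s vL zs s0; have := H2 v z s vL zs s0; split; nra.
  exists (Bp * D + C * Bq + (E + C) * (E + D)).
    by rewrite !addr_ge0 ?mulr_ge0 // addr_ge0.
  move=> v z s vL zs s01; have s0 : 0 <= s by case/andP: s01.
  have -> : \sum_i z i * (p * q)^`M(i).@[v] =
     (\sum_i z i * p^`M(i).@[v]) * q.@[v] + p.@[v] * \sum_i z i * q^`M(i).@[v].
    rewrite mulr_suml mulr_sumr -big_split; apply: eq_bigr => i _ /=.
    rewrite mderivM mevalD !mevalM; ring.
  have [] := HE v z s vL zs s0.
  move: (HC v z s vL zs s01) (HD v z s vL zs s01) (HBp v vL) (HBq v vL).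
  rewrite !mevalM; set a := p.@[_]; set b := q.@[_]; set a0 := p.@[v].
  set b0 := q.@[v]; set da := \sum_i _; set db := \sum_i _.
  move=> h1 h2 h3 h4 h5 h6.
  have ea : `|a - a0| <= (E + C) * s.
    rewrite (_ : a - a0 = da + (a - a0 - da)); last by ring.
    apply: (le_trans (ler_normD _ _)); rewrite mulrDl lerD //.
    by apply: (le_trans h1); rewrite ler_wpM2l // expr2; case/andP: s01 => *; nra.
  have eb : `|b - b0| <= (E + D) * s.
    rewrite (_ : b - b0 = db + (b - b0 - db)); last by ring.
    apply: (le_trans (ler_normD _ _)); rewrite mulrDl lerD //.
    by apply: (le_trans h2); rewrite ler_wpM2l // expr2; case/andP: s01 => *; nra.
  (* Product rule for remainders; the last term is quadratic because each increment is O(s). *)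
  rewrite (_ : _ - _ = a0 * (b - b0 - db) + (a - a0 - da) * b0 + (a - a0) * (b - b0));
    last by ring.
  rewrite (_ : _ * s ^+ 2 = Bp * (D * s ^+ 2) + (C * s ^+ 2) * Bq
              + ((E + C) * s) * ((E + D) * s)); last by ring.
  apply: (le_trans (ler_normD _ _)); apply: lerD.
    by apply: (le_trans (ler_normD _ _)); rewrite !normrM lerD // ler_pM.
  by rewrite normrM ler_pM.
Qed.

Definition shiftp v (j : 'I_m) (s : K) : 'I_m -> K :=
  fun i => v i + (if i == j then s else 0).

(** The density is not polynomial, so Taylor bounds are needed for a larger class: differentiable
    along direction [j] with a uniform quadratic remainder. This class is closed under products and
    under [sqpos]. *)
Definition taylor_along L j (f f' : ('I_m -> K) -> K) :=
  exists2 C, 0 <= C & forall v, (forall i, `|v i| <= L) ->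
    [/\ `|f v| <= C, `|f' v| <= C & forall s, 0 <= s <= 1 ->
      `|f (shiftp v j s) - f v - s * f' v| <= C * s ^+ 2].

Lemma taylor_along_meval L j p :
  taylor_along L j (fun v => p.@[v]) (fun v => p^`M(j).@[v]).
Proof.
have [C C0 HC] := meval_taylor p L.
have [A A0 HA] := meval_bounded p L.
have [B B0 HB] := meval_bounded p^`M(j) L.
exists (A + B + C) => [|v vL]; first by rewrite !addr_ge0.
split; [have := HA v vL; lra | have := HB v vL; lra | move=> s s01].
have zs i : `|if i == j then s else 0| <= s.
  by case/andP: s01 => s0 _; case: ifP; rewrite ?normr0 // ger0_norm.
have := HC v (fun i => if i == j then s else 0) s vL zs s01.
rewrite (bigD1 j) //= eqxx big1 ?addr0 => [h|i /negbTE ->]; last by rewrite mul0r.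
apply: (le_trans h); rewrite ler_wpM2r ?sqr_ge0 //; lra.
Qed.

Lemma taylor_along_mul L j f f' g g' :
  taylor_along L j f f' -> taylor_along L j g g' ->
  taylor_along L j (fun v => f v * g v) (fun v => f' v * g v + f v * g' v).
Proof.
move=> [C C0 HC] [D D0 HD].
exists (C * D * 8) => [|v vL]; first by rewrite !mulr_ge0.
have [f0 f1 f2] := HC v vL; have [g0 g1 g2] := HD v vL.
have CD0 : 0 <= C * D by rewrite mulr_ge0.
have l00 : `|f v * g v| <= C * D by rewrite normrM ler_pM.
have l10 : `|f' v * g v| <= C * D by rewrite normrM ler_pM.
have l01 : `|f v * g' v| <= C * D by rewrite normrM ler_pM.
split.
- lra.
- by apply: (le_trans (ler_normD _ _)); lra.
move=> s s01; have {f2} := f2 s s01; have {g2} := g2 s s01.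
case/andP: s01 => s0 s1.
set a := f (shiftp _ _ _); set b := g (shiftp _ _ _) => hg hf.
have ss : s ^+ 2 <= s by rewrite expr2; nra.
have ea : `|a - f v| <= (2 * C) * s.
  rewrite (_ : a - f v = s * f' v + (a - f v - s * f' v)); last by ring.
  apply: (le_trans (ler_normD _ _)); rewrite normrM (ger0_norm s0); nra.
have eb : `|b - g v| <= (2 * D) * s.
  rewrite (_ : b - g v = s * g' v + (b - g v - s * g' v)); last by ring.
  apply: (le_trans (ler_normD _ _)); rewrite normrM (ger0_norm s0); nra.
rewrite (_ : _ - _ = f v * (b - g v - s * g' v) + (a - f v - s * f' v) * g v
   + (a - f v) * (b - g v)); last by ring.
have e1 : `|f v * (b - g v - s * g' v)| <= C * (D * s ^+ 2) by rewrite normrM ler_pM.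
have e2 : `|(a - f v - s * f' v) * g v| <= C * s ^+ 2 * D by rewrite normrM ler_pM.
have e3 : `|(a - f v) * (b - g v)| <= 2 * C * s * (2 * D * s) by rewrite normrM ler_pM.
apply: (le_trans (ler_normD _ _)).
have := ler_normD (f v * (b - g v - s * g' v)) ((a - f v - s * f' v) * g v).
have : 0 <= C * D * s ^+ 2 by rewrite mulr_ge0 // sqr_ge0.
rewrite (_ : 2 * C * s * (2 * D * s) = 4 * (C * D * s ^+ 2)) in e3; last by ring.
rewrite expr2 in e1 e2 e3 *; nra.
Qed.

(** The square smooths the corner of the positive part: the derivative 2 max(a, 0) exists everywhere
    and is Lipschitz, whence a quadratic remainder. *)
Definition sqpos (a : K) := Num.max a 0 ^+ 2.

Lemma sqpos_ge0 a : 0 <= sqpos a. Proof. exact: sqr_ge0. Qed.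

Lemma sqpos_eq0 a : a <= 0 -> sqpos a = 0.
Proof. by move=> a0; rewrite /sqpos max_r // expr0n. Qed.

Lemma sqpos_taylor a b :
  `|sqpos b - sqpos a - 2 * Num.max a 0 * (b - a)| <= (b - a) ^+ 2.
Proof.
rewrite /sqpos ler_norml.
have := sqr_ge0 a; have := sqr_ge0 b; have := sqr_ge0 (b - a); rewrite !expr2.
case: (leP b 0) => hb; case: (leP a 0) => ha h1 h2 h3.
- lra.
- have : a * b <= 0 by rewrite mulr_ge0_le0 // ltW.
  by lra.
- have : a * b <= 0 by rewrite mulr_le0_ge0 // ltW.
  by lra.
- by lra.
Qed.

Lemma taylor_along_sqpos L j f f' :
  taylor_along L j f f' ->
  taylor_along L j (fun v => sqpos (f v)) (fun v => 2 * Num.max (f v) 0 * f' v).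
Proof.
(* 4 C^2 comes from the squared increment, at most (2 C s)^2; 2 C^2 from the slope 2 max(f, 0) times
   the remainder of [f]. *)
move=> [C C0 HC]; exists (C ^+ 2 * 4 + 2 * C ^+ 2).
  by rewrite addr_ge0 ?mulr_ge0 ?sqr_ge0.
move=> v vL; have [f0 f1 f2] := HC v vL.
have C2 := sqr_ge0 C.
have mC : `|Num.max (f v) 0| <= C.
  by case: (leP (f v) 0) => h; rewrite ?normr0.
have m0 : 0 <= Num.max (f v) 0 by rewrite le_max lexx orbT.
rewrite (ger0_norm m0) in mC.
split.
- rewrite (ger0_norm (sqpos_ge0 _)) /sqpos !expr2 in C2 *; nra.
- rewrite !normrM (ger0_norm m0) ger0_norm //.
  have : Num.max (f v) 0 * `|f' v| <= C * C by rewrite ler_pM.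
  rewrite !expr2 in C2 *; lra.
move=> s s01; have {f2} := f2 s s01.
case/andP: s01 => s0 s1.
set a := f (shiftp _ _ _) => hf.
have ss : s ^+ 2 <= s by rewrite expr2; nra.
have ea : `|a - f v| <= (2 * C) * s.
  rewrite (_ : a - f v = s * f' v + (a - f v - s * f' v)); last by ring.
  apply: (le_trans (ler_normD _ _)); rewrite normrM (ger0_norm s0); nra.
rewrite (_ : _ - _ = (sqpos a - sqpos (f v) - 2 * Num.max (f v) 0 * (a - f v))
  + 2 * Num.max (f v) 0 * (a - f v - s * f' v)); last by ring.
apply: (le_trans (ler_normD _ _)); rewrite [leRHS]mulrDl; apply: lerD.
  apply: (le_trans (sqpos_taylor _ _)); rewrite -[_ ^+ 2]ger0_norm ?sqr_ge0 //.
  rewrite normrX (_ : _ * s ^+ 2 = (2 * C * s) ^+ 2); last by ring.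
  by rewrite lerXn2r ?nnegrE ?mulr_ge0.
rewrite !normrM (ger0_norm m0) ger0_norm //.
rewrite (_ : 2 * C ^+ 2 * s ^+ 2 = 2 * C * (C * s ^+ 2)); last by ring.
by rewrite ler_pM ?mulr_ge0 // ler_pM2l.
Qed.

End TaylorBounds.

(** * Lattice sums of divergences *)

Section LatticeSums.
Variables (K : realFieldType) (n : nat).

Definition insert_at (A : finType) (j : 'I_n.+1) (k : {ffun 'I_n -> A}) (a : A) :
  {ffun 'I_n.+1 -> A} := [ffun i => oapp k a (unlift j i)].

Lemma sum_insert_at (A : finType) j (g : {ffun 'I_n.+1 -> A} -> K) :
  \sum_k g k = \sum_(k : {ffun 'I_n -> A}) \sum_a g (insert_at j k a).
Proof.
rewrite pair_bigA /= (reindex (fun ka : {ffun 'I_n -> A} * A => insert_at j ka.1 ka.2)) //=.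
exists (fun k : {ffun 'I_n.+1 -> A} => ([ffun i => k (lift j i)], k j)).
  move=> [k a] _; rewrite /insert_at !ffunE unlift_none; congr (_, _).
  by apply/ffunP => i; rewrite !ffunE liftK.
move=> k _; apply/ffunP => i; rewrite !ffunE.
by case: unliftP => [i' ->|->] //=; rewrite ffunE.
Qed.

Variables (M : nat) (a b : 'I_n.+1 -> K).
Hypotheses (M0 : (0 < M)%N) (b0 : forall i, 0 < b i).

(** Cells are represented by their lower corners, so a forward step from the last node lands on the
    upper face. *)
Definition grid_point (k : {ffun 'I_n.+1 -> 'I_M}) : 'I_n.+1 -> K :=
  fun i => a i + b i * ((k i)%:R / M%:R).

Definition grid_face (k : {ffun 'I_n -> 'I_M}) (c : K) : 'I_n.+1 -> K :=
  fun i => if unlift ord0 i is Some i'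
           then a i + b i * ((k i')%:R / M%:R) else c.

Let inbox (v : 'I_n.+1 -> K) := forall i, a i <= v i <= a i + b i.

Lemma sum_forward_difference j (f : ('I_n.+1 -> K) -> K) :
  \sum_k (f (shiftp (grid_point k) j (b j / M%:R)) - f (grid_point k)) =
  \sum_(k : {ffun 'I_n -> 'I_M})
    (f (fun i => if unlift j i is Some i' then a i + b i * ((k i')%:R / M%:R) else a i + b i)
     - f (fun i => if unlift j i is Some i' then a i + b i * ((k i')%:R / M%:R) else a i)).
Proof.
have MK : M%:R != 0 :> K by rewrite pnatr_eq0 -lt0n.
rewrite (sum_insert_at j); apply: eq_bigr => k _.
pose g (c : nat) := f (fun i => if unlift j i is Some i'
  then a i + b i * ((k i')%:R / M%:R) else a i + b i * (c%:R / M%:R)).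
transitivity (\sum_(c < M) (g c.+1 - g c)).
  apply: eq_bigr => c _; congr (_ - _); congr f; apply: functional_extensionality => i.
    rewrite /shiftp /grid_point ffunE; case: unliftP => [i' ->|->] /=.
      by rewrite eq_sym (negbTE (neq_lift j i')) addr0.
    by rewrite eqxx -natr1; field.
  by rewrite /grid_point ffunE; case: unliftP.
rewrite -(big_mkord predT (fun c => g c.+1 - g c)) telescope_sumr //.
congr (_ - _); congr f; apply: functional_extensionality => i; case: unliftP => // _.
  by rewrite divff // mulr1.
by rewrite mul0r mulr0 addr0.
Qed.

(** A discrete divergence theorem. Differences in the space directions telescope to face values,
    which are 0. Divided by their steps, all differences add up to the divergence, which is 0, plus
    Taylor errors C b_j / M at M^(n+1) nodes; multiplying by the time step b_0 / M gives the
    bound. *)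
Lemma lattice_divergence (f f' : 'I_n.+1 -> ('I_n.+1 -> K) -> K) (C : K) :
  0 <= C ->
  (forall j v, inbox v -> inbox (shiftp v j (b j / M%:R)) ->
    `|f j (shiftp v j (b j / M%:R)) - f j v - b j / M%:R * f' j v|
       <= C * (b j / M%:R) ^+ 2) ->
  (forall j v, j != ord0 -> inbox v -> v j = a j \/ v j = a j + b j -> f j v = 0) ->
  (forall v, inbox v -> \sum_j f' j v = 0) ->
  `|\sum_k (f ord0 (grid_face k (a ord0 + b ord0)) - f ord0 (grid_face k (a ord0)))|
    <= C * b ord0 * (\sum_j b j) * M%:R ^+ n / M%:R.
Proof.
move=> C0 taylor face div.
have MK0 : 0 < (M%:R : K) by rewrite ltr0n.
have MK : M%:R != 0 :> K by rewrite gt_eqF.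
have frac (c : 'I_M) : 0 <= (c%:R / M%:R : K) <= 1.
  by rewrite divr_ge0 ?ler0n // andTb ler_pdivrMr // mul1r ler_nat ltnW.
have inb i (x : K) : 0 <= x <= 1 -> a i <= a i + b i * x <= a i + b i.
  by have := b0 i; move=> bi /andP[x0 x1]; apply/andP; split; nra.
have step j : 0 < b j / M%:R by rewrite divr_gt0.
pose D j k := f j (shiftp (grid_point k) j (b j / M%:R)) - f j (grid_point k).
have gin k : inbox (grid_point k) by move=> i; apply/inb/frac.
have gin' k j : inbox (shiftp (grid_point k) j (b j / M%:R)).
  move=> i; rewrite /shiftp; case: eqP => [->|_]; last by rewrite addr0; apply: gin.
  rewrite /grid_point (_ : _ + _ = a j + b j * ((k j).+1%:R / M%:R)).
    by apply: inb; rewrite divr_ge0 ?ler0n // andTb ler_pdivrMr // mul1r ler_nat.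
  by rewrite -natr1; field.
have Dj j : j != ord0 -> \sum_k D j k = 0.
  move=> j0; rewrite sum_forward_difference; apply: big1 => k _.
  rewrite !face ?subrr //; try by (right + left); rewrite unlift_none.
    move=> i; case: unliftP => [i' _|_]; first exact/inb/frac.
    by rewrite lexx lerDl ltW.
  move=> i; case: unliftP => [i' _|_]; first exact/inb/frac.
  by rewrite lexx lerDl ltW.
have D0 : \sum_k D ord0 k =
  \sum_k (f ord0 (grid_face k (a ord0 + b ord0)) - f ord0 (grid_face k (a ord0))).
  rewrite sum_forward_difference; apply: eq_bigr => k _.
  congr (_ - _); congr (f ord0 _); apply: functional_extensionality => i;
    by rewrite /grid_face; case: unliftP => [//|->].
rewrite -D0.
have key : `|\sum_j (b j / M%:R)^-1 * \sum_k D j k| <=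
    \sum_j \sum_(k : {ffun 'I_n.+1 -> 'I_M}) C * (b j / M%:R).
  rewrite (_ : \sum_j _ = \sum_j \sum_k
     ((b j / M%:R)^-1 * (D j k - b j / M%:R * f' j (grid_point k)))).
    apply: (le_trans (ler_norm_sum _ _ _)); apply: ler_sum => j _.
    apply: (le_trans (ler_norm_sum _ _ _)); apply: ler_sum => k _.
    rewrite normrM ger0_norm ?invr_ge0 ?(ltW (step j)) //.
    rewrite ler_pdivrMl //; apply: (le_trans (taylor _ _ _ _)) => //.
    by rewrite le_eqVlt; apply/orP; left; apply/eqP; ring.
  have -> : \sum_j (b j / M%:R)^-1 * \sum_k D j k =
     \sum_j \sum_k (b j / M%:R)^-1 * D j k.
    by apply: eq_bigr => j _; rewrite mulr_sumr.
  apply/eqP; rewrite -subr_eq0 -sumrB.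
  rewrite (eq_bigr (fun j => \sum_k f' j (grid_point k))).
    by rewrite exchange_big /= big1 // => k _; rewrite div.
  move=> j _; rewrite -sumrB; apply: eq_bigr => k _.
  move: (D j k) (f' j _) (lt0r_neq0 (step j)) => d e s0.
  by rewrite mulrBr mulrA mulVf // mul1r subKr.
rewrite (bigD1 ord0) //= [X in _ + X]big1 ?addr0 in key; last first.
  by move=> j j0; rewrite Dj // mulr0.
rewrite normrM gtr0_norm ?invr_gt0 // in key.
rewrite ler_pdivrMl // in key.
apply: (le_trans key); rewrite le_eqVlt; apply/orP; left; apply/eqP.
rewrite (eq_bigr (fun j => M%:R ^+ n * C * b j)).
  by rewrite -mulr_sumr; field.
move=> j _; rewrite sumr_const card_ffun !card_ord -[_ *+ (M ^ _)]mulr_natl natrX exprS.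
by field.
Qed.

End LatticeSums.

(** * Homotopy invariance *)

Section Homotopy.
Variables (K : realFieldType) (n : nat).
Implicit Types (G : 'I_n -> {mpoly K[n.+1]}) (B : pred ('I_n -> K)).

(* Variable [0] of a polynomial is the time of a homotopy, the others are space. *)
Definition timed (t : K) (x : 'I_n -> K) : 'I_n.+1 -> K :=
  fun i => oapp x t (unlift ord0 i).

Lemma timed_lift t x i : timed t x (lift ord0 i) = x i.
Proof. by rewrite /timed liftK. Qed.

Lemma timed0 t x : timed t x ord0 = t.
Proof. by rewrite /timed unlift_none. Qed.

Lemma timedK t x : (fun i => timed t x (lift ord0 i)) = x.
Proof. by apply: functional_extensionality => i; rewrite timed_lift. Qed.

Lemma timed_eta v : timed (v ord0) (fun i => v (lift ord0 i)) = v.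
Proof.
by apply: functional_extensionality => i; rewrite /timed; case: unliftP => [j ->|->].
Qed.

Definition lattice_point (L : K) M (k : {ffun 'I_n -> 'I_M}) : 'I_n -> K :=
  fun i => - L + 2 * L * ((k i)%:R / M%:R).

Definition lattice_sum (L : K) M (f : ('I_n -> K) -> K) : K :=
  \sum_(k : {ffun 'I_n -> 'I_M}) f (lattice_point L k).

Definition spatial_jacobian G := \matrix_(i, j) (G i)^`M(lift ord0 j).

(* The pull-back under [G] of the bump form [sqpos (rho2 - |y|^2) dy], cut off
   outside [B]. *)
Definition degree_density G B (rho2 : K) (v : 'I_n.+1 -> K) : K :=
  if B (fun i => v (lift ord0 i)) then
    sqpos (rho2 - \sum_i (G i).@[v] ^+ 2) * (\det (spatial_jacobian G)).@[v]
  else 0.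

(** The cut-off by [B] needs no smoothing: at a point of [B] within [eta] of the complement the
    hypothesis makes the bump and its derivatives vanish, and a lattice step of length at most [eta]
    leaves or enters [B] only at such points. *)
Lemma lattice_homotopy G B (rho2 L eta : K) :
  0 < L -> 0 < eta ->
  (forall x, B x -> forall i, `|x i| < L) ->
  (forall x y t, B x -> ~~ B y -> (forall i, `|x i - y i| <= eta) ->
     0 <= t <= 1 -> rho2 <= \sum_i (G i).@[timed t x] ^+ 2) ->
  exists C M0 : K, forall M, (0 < M)%N -> M0 <= M%:R ->
   `|lattice_sum L M (fun x => degree_density G B rho2 (timed 1 x))
     - lattice_sum L M (fun x => degree_density G B rho2 (timed 0 x))|
     <= C * M%:R ^+ n / M%:R.
Proof.
move=> L0 eta0 BL Beta.
pose q : {mpoly K[n.+1]} := rho2%:MP - \sum_i G i ^+ 2.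
pose cof j := cofactor (jacobian G) ord0 j.
have qE v : q.@[v] = rho2 - \sum_i (G i).@[v] ^+ 2.
  rewrite /q mevalB mevalC (raddf_sum (meval v)) /=; congr (_ - _).
  by apply: eq_bigr => i _; rewrite rmorphXn.
pose pr (v : 'I_n.+1 -> K) := fun i => v (lift ord0 i).
pose g j v := sqpos q.@[v] * (cof j).@[v].
pose g' j v := 2 * Num.max q.@[v] 0 * q^`M(j).@[v] * (cof j).@[v]
               + sqpos q.@[v] * (cof j)^`M(j).@[v].
(* Half-width L + 1 covers both the space coordinates, up to L, and the time, up to 1. *)
have [C HC] : exists C : 'I_n.+1 -> K, forall j, 0 <= C j /\
    forall v, (forall i, `|v i| <= L + 1) -> forall s, 0 <= s <= 1 ->
      `|g j (shiftp v j s) - g j v - s * g' j v| <= C j * s ^+ 2.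
  apply: (fin_all_exists (P := fun j C => 0 <= C /\
    forall v, (forall i, `|v i| <= L + 1) -> forall s, 0 <= s <= 1 ->
      `|g j (shiftp v j s) - g j v - s * g' j v| <= C * s ^+ 2)) => j.
  have [C C0 HC] := taylor_along_mul
    (taylor_along_sqpos (taylor_along_meval (L + 1) j q))
    (taylor_along_meval (L + 1) j (cof j)).
  by exists C; split=> // v vL; case: (HC v vL).
pose a (i : 'I_n.+1) : K := oapp (fun=> - L) 0 (unlift ord0 i).
pose b (i : 'I_n.+1) : K := oapp (fun=> 2 * L) 1 (unlift ord0 i).
have b0 i : 0 < b i by rewrite /b; case: unlift => [j|] //=; lra.
pose D := \sum_j C j.
have DC j : C j <= D.
  rewrite /D (bigD1 j) //= lerDl; apply: sumr_ge0 => i _; by case: (HC i).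
have D0 : 0 <= D by apply: sumr_ge0 => i _; by case: (HC i).
(* M >= 2L + 1 keeps every step at most 1, as the Taylor estimate requires; M >= 2L/eta keeps the
   space steps at most [eta]. *)
exists (D * b ord0 * (\sum_j b j)), (2 * L + 1 + 2 * L / eta) => M M0 MM.
have MK0 : 0 < (M%:R : K) by rewrite ltr0n.
pose f j v := if B (pr v) then g j v else 0.
pose f' j v := if B (pr v) then g' j v else 0.
have aL : forall v, (forall i, a i <= v i <= a i + b i) ->
    (forall i, `|v i| <= L + 1) /\ 0 <= v ord0 <= 1.
  move=> v vb; split; last first.
    by have := vb ord0; rewrite /a /b unlift_none /= add0r.
  move=> i; have := vb i; rewrite /a /b ler_norml; case: unlift => [_|] /=;
    move=> /andP[h1 h2]; apply/andP; split; lra.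
have sE : 0 < L / eta by rewrite divr_gt0.
have smallb j : 0 <= b j / M%:R <= 1.
  rewrite ltW ?divr_gt0 //= ler_pdivrMr // mul1r /b.
  case: unlift => [_|] /=; lra.
have smalleta j : j != ord0 -> b j / M%:R <= eta.
  rewrite ler_pdivrMr // /b; case: unliftP => [i _|-> /[!eqxx]//] _ /=.
  rewrite -ler_pdivrMl // mulrC; lra.
have bdry v y : (forall i, a i <= v i <= a i + b i) -> B (pr v) -> ~~ B y ->
    (forall i, `|pr v i - y i| <= eta) -> q.@[v] <= 0.
  move=> vb Bv By vy; rewrite qE subr_le0 -(timed_eta v).
  by apply: (Beta _ y) => //; case: (aL v vb).
have near v j i : `|pr v i - pr (shiftp v j (b j / M%:R)) i| <= eta.
  rewrite /pr /shiftp opprD addrA subrr sub0r normrN.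
  case: eqP => [jl|_]; last by rewrite normr0 ltW.
  rewrite ger0_norm; last by case/andP: (smallb j).
  by apply: smalleta; rewrite -jl eq_sym neq_lift.
rewrite /lattice_sum -sumrB.
have a00 : a ord0 = 0 by rewrite /a unlift_none.
have b01 : a ord0 + b ord0 = 1 by rewrite a00 /b unlift_none add0r.
have ff t (k : {ffun 'I_n -> 'I_M}) :
   degree_density G B rho2 (timed t (lattice_point L k)) = f ord0 (grid_face a b k t).
  have -> : grid_face a b k t = timed t (lattice_point L k).
    apply: functional_extensionality => i; rewrite /grid_face /timed /a /b.
    by case: unliftP.
  by rewrite /degree_density /f /g qE /cof cofactor_jacobian0.
under eq_bigr do rewrite !ff -[X in grid_face _ _ _ X]b01 -[X in _ - f _ (grid_face _ _ _ X)]a00.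
apply: (@lattice_divergence K n M a b M0 b0 f f' D D0).
- move=> j v vb vb'; rewrite /f /f'.
  set v' := shiftp v j _ in vb' *; set s := b j / _.
  have v'v i : `|pr v' i - pr v i| <= eta by rewrite distrC near.
  have s2 : 0 <= D * s ^+ 2 by rewrite mulr_ge0 ?sqr_ge0.
  (* If only one end of the step lies in [B], then q <= 0 at that end, where both [g] and [g'] are
     0. *)
  case: ifPn => Bv'; case: ifPn => Bv.
  + have [Cj0 HCj] := HC j; have [vL _] := aL v vb.
    apply: (le_trans (HCj v vL s (smallb j))).
    by rewrite ler_wpM2r ?sqr_ge0.
  + have q0 := bdry v' (pr v) vb' Bv' Bv v'v.
    by rewrite /g sqpos_eq0 // mul0r mulr0 !subr0 normr0.
  + have q0 := bdry v (pr v') vb Bv Bv' (near v j).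
    rewrite /g /g' sqpos_eq0 // max_r //.
    by rewrite !(mul0r, mulr0, addr0, subr0, normr0).
  + by rewrite mulr0 !subr0 normr0.
(* On a face in a space direction some |x i| equals L, so the face misses [B]. *)
- move=> j v j0 vb vj; rewrite /f ifN //; apply/negP => Bv.
  move: j0 vj; case: (unliftP ord0 j) => [i ->|-> /[!eqxx]//] _.
  rewrite /a /b liftK /=; have := BL _ Bv i; rewrite /pr ltr_norml.
  by move=> /andP[h1 h2] []; lra.
- move=> v vb; rewrite /f'; case: (B (pr v)); last by rewrite big1.
  rewrite /g' big_split /= -mulr_sumr.
  have -> : \sum_i (cof i)^`M(i).@[v] = 0.
    by rewrite -(raddf_sum (meval v)) /= divergence_cofactor meval0.
  rewrite mulr0 addr0; under eq_bigr do rewrite -mulrA.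
  rewrite -mulr_sumr; apply/eqP; rewrite mulf_eq0; apply/orP; right; apply/eqP.
  (* dq is a combination of the rows dG_i, each of which is orthogonal to the cofactors. *)
  transitivity (\sum_i - (2 * (G i).@[v] * \sum_j (cof j * (G i)^`M(j)).@[v])).
    under [RHS]eq_bigr do rewrite mulr_sumr -sumrN.
    rewrite exchange_big /=; apply: eq_bigr => j _.
    have -> : q^`M(j) = - \sum_i 2 * G i * (G i)^`M(j).
      rewrite /q mderivB mderivC sub0r (raddf_sum (mderiv j)) /=; congr (- _).
      by apply: eq_bigr => i _; rewrite expr2 mderivM; ring.
    rewrite mevalN (raddf_sum (meval v)) /= mulNr mulr_suml -sumrN; apply: eq_bigr => i _.
    rewrite !mevalM mulr2n mevalD meval1; ring.
  apply: big1 => i _; rewrite -(raddf_sum (meval v)) /=.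
  by rewrite cofactor_row_jacobian meval0 mulr0 oppr0.
Qed.

End Homotopy.

(** * Local degree *)

Section BallDegree.
Variables (K : realFieldType) (n : nat).
Implicit Types (G : 'I_n -> {mpoly K[n.+1]}) (x a z : 'I_n -> K).

(** Distances stay squared, so that they are polynomial and make sense over any real field; the
    price is the factor 2 in the triangle inequality. *)
Definition sqnorm x : K := \sum_i x i ^+ 2.
Definition sqdist x a : K := sqnorm (fun i => x i - a i).

Lemma sqnorm_ge0 x : 0 <= sqnorm x.
Proof. by apply: sumr_ge0 => i _; exact: sqr_ge0. Qed.

Lemma sqr_le_sqnorm x i : x i ^+ 2 <= sqnorm x.
Proof.
rewrite /sqnorm (bigD1 i) //= lerDl; apply: sumr_ge0 => j _; exact: sqr_ge0.
Qed.

Lemma sqnormD_le x z : sqnorm (fun i => x i + z i) <= 2 * sqnorm x + 2 * sqnorm z.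
Proof.
rewrite /sqnorm !mulr_sumr -big_split; apply: ler_sum => i _ /=.
have := sqr_ge0 (x i - z i); rewrite !expr2; lra.
Qed.

Lemma sqnorm_eq0 x : sqnorm x = 0 -> x = fun=> 0.
Proof.
move=> x0; apply: functional_extensionality => i; apply/eqP.
by rewrite -sqrf_eq0 eq_le sqr_ge0 andbT -x0; exact: sqr_le_sqnorm.
Qed.

Lemma sqdist_ge0 x z : 0 <= sqdist x z.
Proof. exact: sqnorm_ge0. Qed.

Lemma sqdistC x z : sqdist x z = sqdist z x.
Proof. by apply: eq_bigr => i _; rewrite -sqrrN opprB. Qed.

Lemma sqdistx0 x : sqdist x (fun=> 0) = sqnorm x.
Proof. by apply: eq_bigr => i _; rewrite subr0. Qed.

Lemma sqdistxx x : sqdist x x = 0.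
Proof. by apply: big1 => i _; rewrite subrr expr0n. Qed.

Lemma sqdist_eq0 x z : sqdist x z = 0 -> x = z.
Proof.
move=> /sqnorm_eq0 xz; apply: functional_extensionality => i; apply/eqP.
by rewrite -subr_eq0; apply/eqP; exact: (congr1 (fun f => f i) xz).
Qed.

Lemma sqdist_triangle x y z : sqdist x z <= 2 * sqdist x y + 2 * sqdist y z.
Proof.
have := sqnormD_le (fun i => x i - y i) (fun i => y i - z i).
rewrite (_ : sqnorm _ = sqdist x z) //.
by apply: eq_bigr => i _; congr (_ ^+ 2); ring.
Qed.

Lemma sqdist_lt_of_close (d : K) : 0 < d ->
  exists2 e, 0 < e & forall x z, (forall i, `|x i - z i| <= e) -> sqdist x z < d.
Proof.
move=> d0; pose n1 : K := n%:R + 1.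
have n10 : 0 < n1 by rewrite /n1 ltr_wpDl.
pose e := Num.min 1 (d / (2 * n1)).
exists e => [|x z xz]; first by rewrite lt_min ltr01 divr_gt0 ?mulr_gt0.
apply: (@le_lt_trans _ _ (\sum_(i < n) e)).
  apply: ler_sum => i _; have := xz i => h.
  have e1 : e <= 1 by rewrite /e ge_min lexx.
  rewrite -[_ ^+ 2]ger0_norm ?sqr_ge0 // normrX expr2.
  have := normr_ge0 (x i - z i); nra.
rewrite sumr_const card_ord -mulr_natr.
have : e <= d / (2 * n1) by rewrite /e ge_min lexx orbT.
have e0 : 0 < e by rewrite lt_min ltr01 divr_gt0 ?mulr_gt0.
rewrite ler_pdivlMr ?mulr_gt0 // /n1; nra.
Qed.

Lemma sum_id_mx z i : \sum_j (1%:M : 'M[K]_n) i j * z j = z i.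
Proof.
rewrite (bigD1 i) //= mxE eqxx mul1r big1 ?addr0 // => j ji.
by rewrite mxE eq_sym (negbTE ji) mul0r.
Qed.

Lemma cauchy_schwarz x z : (\sum_i x i * z i) ^+ 2 <= sqnorm x * sqnorm z.
Proof.
set p := \sum_i _; have [z0|z0] := eqVneq (sqnorm z) 0.
  rewrite /p big1 ?expr0n /= ?mulr_ge0 ?sqnorm_ge0 // => i _.
  by rewrite (sqnorm_eq0 z0) mulr0.
have zp : 0 < sqnorm z by rewrite lt_neqAle eq_sym z0 sqnorm_ge0.
have := sqnorm_ge0 (fun i => sqnorm z * x i - p * z i).
have -> : sqnorm (fun i => sqnorm z * x i - p * z i) =
   sqnorm z * (sqnorm z * sqnorm x - p ^+ 2).
  rewrite {1}/sqnorm (eq_bigr (fun i => sqnorm z ^+ 2 * x i ^+ 2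
     + (- 2 * sqnorm z * p) * (x i * z i) + p ^+ 2 * z i ^+ 2)); last by move=> i _; ring.
  rewrite !big_split -!mulr_sumr /= -/(sqnorm x) -/(sqnorm z) -/p; ring.
by rewrite pmulr_rge0 // subr_ge0 mulrC.
Qed.

(** The homotopy is H = (1 - t) G + t A (x - a). On the shell R2/4 <= |x - a|^2 < R2 its pairing
    with A (x - a) is at least min(c, R2/4). By Cauchy-Schwarz and |A (x - a)|^2 < R2 this forces
    |H|^2 >= rho2, the two upper bounds on [rho2] matching the two values of the minimum. At t = 1
    the density is det A times the bump at [a]. *)
Lemma ball_degree G (A : 'M[K]_n) a (R2 c rho2 L : K) :
  0 < L -> (forall z, sqnorm (fun i => \sum_j A i j * z j) = sqnorm z) ->
  (forall i t x, (G i).@[timed t x] = (G i).@[timed 0 x]) ->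
  0 < R2 -> 0 < c -> rho2 * R2 <= c ^+ 2 -> 16 * rho2 <= R2 ->
  (forall x, sqdist x a < R2 -> forall i, `|x i| < L) ->
  (forall x, R2 / 4 <= sqdist x a -> sqdist x a < R2 ->
     c <= \sum_i (G i).@[timed 0 x] * \sum_j A i j * (x j - a j)) ->
  exists C M0 : K, forall M, (0 < M)%N -> M0 <= M%:R ->
   `|lattice_sum L M (fun x =>
        degree_density G (fun y => sqdist y a < R2) rho2 (timed 0 x))
     - \det A * lattice_sum L M (fun x => sqpos (rho2 - sqdist x a))|
     <= C * M%:R ^+ n / M%:R.
Proof.
move=> L0 isoA static R20 c0 rc rR BL bc.
pose lin i := \sum_j (A i j)%:MP * ('X_(lift ord0 j) - (a j)%:MP) : {mpoly K[n.+1]}.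
pose H i := (1 - 'X_ord0) * G i + 'X_ord0 * lin i.
have linE i t x : (lin i).@[timed t x] = \sum_j A i j * (x j - a j).
  rewrite (raddf_sum (meval _)) /=; apply: eq_bigr => j _.
  by rewrite mevalM mevalB !mevalC mevalXU timed_lift.
have HE i t x : (H i).@[timed t x] =
    (1 - t) * (G i).@[timed 0 x] + t * \sum_j A i j * (x j - a j).
  rewrite mevalD !mevalM mevalB meval1 mevalXU timed0 linE; congr (_ * _ + _).
  exact: static.
have dH i j t x : ((H i)^`M(lift ord0 j)).@[timed t x] =
    (1 - t) * ((G i)^`M(lift ord0 j)).@[timed t x] + t * A i j.
  rewrite mderivD !mderivM mderivB !mderivXU -mpolyC1 mderivC /=.
  rewrite (_ : (lin i)^`M(lift ord0 j) = (A i j)%:MP); last first.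
    rewrite (raddf_sum (mderiv _)) /= (bigD1 j) //= big1 ?addr0 => [|k kj].
      by rewrite mderivM mderivB !mderivC mderivXU eqxx subr0 mulr1 mul0r add0r.
    rewrite mderivM mderivB !mderivC mderivXU subr0 mul0r add0r.
    by rewrite (inj_eq lift_inj) eq_sym (negbTE kj) mulr0.
  by rewrite subr0 !mul0r !add0r mevalD !mevalM mevalB !mevalC mevalXU timed0.
clearbody H.
pose B y := sqdist y a < R2.
have iso_c t x : 0 <= t <= 1 -> R2 / 4 <= sqdist x a -> sqdist x a < R2 ->
   rho2 <= \sum_i (H i).@[timed t x] ^+ 2.
  move=> /andP[t0 t1] x1 x2.
  have := cauchy_schwarz (fun i => (H i).@[timed t x])
            (fun i => \sum_j A i j * (x j - a j)).
  rewrite (isoA (fun j => x j - a j)) -/(sqdist x a).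
  rewrite (eq_bigr (fun i =>
     (1 - t) * ((G i).@[timed 0 x] * \sum_j A i j * (x j - a j))
      + t * (\sum_j A i j * (x j - a j)) ^+ 2)); last first.
    by move=> i _; rewrite HE; ring.
  rewrite big_split -!mulr_sumr /=.
  rewrite -/(sqnorm (fun i => \sum_j A i j * (x j - a j))).
  rewrite (isoA (fun j => x j - a j)) -/(sqdist x a).
  have := bc x x1 x2; set p := \sum_i (_ * _) => pc.
  rewrite -/(sqnorm (fun i => (H i).@[timed t x])).
  set h := sqnorm _; set d := sqdist x a => CS.
  have h0 : 0 <= h := sqnorm_ge0 _.
  pose e := (1 - t) * p + t * d.
  have lb m : m <= p -> m <= d -> m <= e.
    move=> mp md; rewrite -subr_ge0 (_ : e - m = (1 - t) * (p - m) + t * (d - m)).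
      by rewrite addr_ge0 // mulr_ge0 // subr_ge0.
    by rewrite /e; ring.
  have e1 : rho2 * R2 <= e ^+ 2.
    have [cR|cR] := leP c (R2 / 4).
      have ce : c <= e by apply: lb => //; apply: le_trans x1.
      have c1 := ltW c0; have e0 := le_trans c1 ce.
      by apply: (le_trans rc); rewrite lerXn2r.
    have Re : R2 / 4 <= e by apply: lb => //; apply: le_trans pc; exact: ltW.
    apply: (@le_trans _ _ ((R2 / 4) ^+ 2)); first by rewrite expr2; nra.
    have R4 : 0 <= R2 / 4 by lra.
    by have e0 := le_trans R4 Re; rewrite lerXn2r.
  have hR : h * d <= h * R2 by rewrite ler_wpM2l // ltW.
  by rewrite -(ler_pM2r R20); apply: (le_trans e1); apply: (le_trans CS).
(* If |x - y|^2 < R2/4 and |y - a|^2 >= R2, the doubled triangle inequality gives |x - a|^2 > R2/4: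
   points of the ball close to its complement lie in the shell. *)
have [eta eta0 Heta] : exists2 eta, 0 < eta & forall x z : 'I_n -> K,
    (forall i, `|x i - z i| <= eta) -> sqdist x z < R2 / 4.
  by apply: sqdist_lt_of_close; rewrite divr_gt0.
have [|C [M0 HC]] := @lattice_homotopy K n H B rho2 L eta L0 eta0 BL.
  move=> x y t Bx By xy t01; apply: iso_c => //.
  have yR : R2 <= sqdist y a by rewrite leNgt.
  have := sqdist_triangle y x a; rewrite (sqdistC y x).
  have := Heta x y xy; lra.
exists C, M0 => M Mp MM.
have e0 : lattice_sum L M (fun x => degree_density H B rho2 (timed 0 x)) =
    lattice_sum L M (fun x => degree_density G B rho2 (timed 0 x)).
  rewrite /lattice_sum; apply: eq_bigr => k _.
  rewrite /degree_density timedK; case: (B _); last by [].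
  set x := lattice_point _ _.
  have -> : \sum_i (H i).@[timed 0 x] ^+ 2 = \sum_i (G i).@[timed 0 x] ^+ 2.
    by apply: eq_bigr => i _; rewrite HE; ring.
  rewrite -!det_map_mx.
  suff -> : map_mx (meval (timed 0 x)) (spatial_jacobian H) =
     map_mx (meval (timed 0 x)) (spatial_jacobian G) by [].
  apply/matrixP => i j; rewrite !mxE dH; ring.
have e1 : lattice_sum L M (fun x => degree_density H B rho2 (timed 1 x)) =
    \det A * lattice_sum L M (fun x => sqpos (rho2 - sqdist x a)).
  rewrite /lattice_sum mulr_sumr; apply: eq_bigr => k _.
  rewrite /degree_density timedK; set x := lattice_point _ _.
  have -> : \sum_i (H i).@[timed 1 x] ^+ 2 = sqdist x a.
    rewrite /sqdist -(isoA (fun j => x j - a j)); apply: eq_bigr => i _.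
    by rewrite HE; ring.
  rewrite -det_map_mx (_ : map_mx _ _ = A); last first.
    by apply/matrixP => i j; rewrite !mxE /= dH; ring.
  have [xR|xR] := boolP (B x); first exact: mulrC.
  have -> : sqpos (rho2 - sqdist x a) = 0.
    apply: sqpos_eq0.
    have xR' : R2 <= sqdist x a by rewrite leNgt.
    by clear e0; lra.
  by rewrite mulr0.
rewrite -e1 -e0 distrC; exact: HC M Mp MM.
Qed.

(** The lattice is not invariant under translation by [a], so bumps centred at different zeros have
    to be compared with the one at 0. This is [ball_degree] for the field x - a and A = 1 on a ball
    about 0. *)
Lemma bump_translate a (R2 rho2 L : K) :
  0 < L -> 0 < R2 -> sqnorm a < R2 / 4 -> 0 < rho2 ->
  16 * rho2 <= R2 -> rho2 * R2 <= ((R2 / 4 - sqnorm a) / 2) ^+ 2 ->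
  (forall x, sqnorm x < R2 -> forall i, `|x i| < L) ->
  exists C M0 : K, forall M, (0 < M)%N -> M0 <= M%:R ->
   `|lattice_sum L M (fun x => sqpos (rho2 - sqdist x a))
     - lattice_sum L M (fun x => sqpos (rho2 - sqnorm x))|
     <= C * M%:R ^+ n / M%:R.
Proof.
move=> L0 R20 aR r0 rR rc BL.
pose G i : {mpoly K[n.+1]} := 'X_(lift ord0 i) - (a i)%:MP.
have GE i t x : (G i).@[timed t x] = x i - a i.
  by rewrite mevalB mevalXU mevalC timed_lift.
have [|||||||||C [M0 HC]] := @ball_degree G 1%:M (fun=> 0) R2
   ((R2 / 4 - sqnorm a) / 2) rho2 L.
- by [].
- by move=> z; apply: eq_bigr => i _; rewrite sum_id_mx.
- by move=> i t x; rewrite !GE.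
- by [].
- lra.
- by [].
- by [].
- by move=> x; rewrite sqdistx0; apply: BL.
(* <x - a, x> >= (|x|^2 - |a|^2) / 2, which on the shell is at least the chosen c. *)
- move=> x; rewrite sqdistx0 => x1 x2.
  rewrite (eq_bigr (fun i => x i ^+ 2 - a i * x i)); last first.
    move=> i _; rewrite GE (sum_id_mx (fun j => x j - 0)); ring.
  rewrite sumrB -/(sqnorm x).
  have : \sum_i a i * x i <= (sqnorm a + sqnorm x) / 2.
    rewrite /sqnorm -big_split mulr_suml; apply: ler_sum => i _ /=.
    have := sqr_ge0 (a i - x i); rewrite !expr2; lra.
  lra.
exists C, M0 => M Mp MM; have := HC M Mp MM; rewrite det1 mul1r.
have -> : lattice_sum L M (fun x => sqpos (rho2 - sqdist x (fun=> 0))) =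
    lattice_sum L M (fun x => sqpos (rho2 - sqnorm x)).
  by rewrite /lattice_sum; apply: eq_bigr => k _; rewrite sqdistx0.
suff -> : lattice_sum L M (fun x =>
    degree_density G (fun y => sqdist y (fun=> 0) < R2) rho2 (timed 0 x)) =
    lattice_sum L M (fun x => sqpos (rho2 - sqdist x a)) by [].
rewrite /lattice_sum; apply: eq_bigr => k _; rewrite /degree_density timedK sqdistx0.
set x := lattice_point _ _.
have -> : \sum_i (G i).@[timed 0 x] ^+ 2 = sqdist x a.
  by apply: eq_bigr => i _; rewrite GE.
rewrite -det_map_mx (_ : map_mx _ _ = 1%:M); last first.
  apply/matrixP => i j; rewrite !mxE /= mderivB mderivC mderivXU subr0.
  by rewrite (inj_eq lift_inj) eq_sym rmorph_nat.
rewrite det1 mulr1; case: ltP => [_|xR]; first reflexivity.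
rewrite sqpos_eq0; first reflexivity.
(* Outside the ball |x - a|^2 >= R2/2 - |a|^2 > R2/4, beyond the support of the bump. *)
have := sqdist_triangle x a (fun=> 0); rewrite !sqdistx0; lra.
Qed.

(** For M = 2 Q m the indices Q m, ..., Q m + m - 1 in every coordinate give m^n nodes in the cube
    [0, L/Q)^n, where |x|^2 <= rho2/2 by the choice of Q. So the sum is at least a fixed fraction of
    M^n. *)
Lemma bump_lower_bound (L rho2 : K) (Q m : nat) :
  (0 < Q)%N -> (0 < m)%N -> 0 < L -> 2 * n%:R * L ^+ 2 <= rho2 * Q%:R ^+ 2 -> 0 <= rho2 ->
  (rho2 / 2) ^+ 2 * m%:R ^+ n <=
    lattice_sum L (2 * Q * m) (fun x => sqpos (rho2 - sqnorm x)).
Proof.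
move=> Q0 m0 L0 Qr r0.
have lt_off (c : 'I_m) : (Q * m + c < 2 * Q * m)%N.
  rewrite mul2n -addnn mulnDl ltn_add2l; apply: leq_trans (ltn_ord c) _.
  by rewrite leq_pmull.
pose off (k : {ffun 'I_n -> 'I_m}) : {ffun 'I_n -> 'I_(2 * Q * m)} :=
  [ffun i => Ordinal (lt_off (k i))].
have offI : injective off.
  move=> k k' /ffunP e; apply/ffunP => i; apply: val_inj.
  by have := e i; rewrite !ffunE => /(congr1 val) /= /addnI.
rewrite /lattice_sum (bigID (mem (off @: predT))) /= ler_wpDr //.
  by apply: sumr_ge0 => *; apply: sqpos_ge0.
rewrite big_imset /=; last exact: in2W offI.
rewrite mulrC -natrX -{1}[m]card_ord -[X in (_ ^ X)%N]card_ord -card_ffun mulr_natl.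
rewrite -sumr_const; apply: ler_sum => k _.
have bound : sqnorm (lattice_point L (off k)) <= rho2 / 2.
  apply: (@le_trans _ _ (\sum_(i < n) L ^+ 2 / Q%:R ^+ 2)); last first.
    rewrite sumr_const card_ord -[_ *+ n]mulr_natl mulrA ler_pdivrMr ?exprn_gt0 ?ltr0n //.
    lra.
  apply: ler_sum => i _; rewrite /lattice_point /off ffunE /=.
  have mK : 0 < (m%:R : K) by rewrite ltr0n.
  have QK : 0 < (Q%:R : K) by rewrite ltr0n.
  rewrite (_ : - L + _ = L * ((k i)%:R / m%:R) / Q%:R); last first.
    rewrite natrD !natrM; field; rewrite !gt_eqF //.
  have : (k i)%:R / m%:R <= (1 : K).
    by rewrite ler_pdivrMr // mul1r ler_nat ltnW.
  have : 0 <= ((k i)%:R / m%:R : K) by rewrite divr_ge0.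
  move: (_ / _ : K) => f f0 f1.
  rewrite exprMn exprVn ler_wpM2r ?invr_ge0 ?exprn_ge0 ?(ltW QK) //.
  rewrite lerXn2r ?nnegrE ?mulr_ge0 ?(ltW L0) //; nra.
rewrite /sqpos max_l; last lra.
by rewrite lerXn2r ?nnegrE //; lra.
Qed.

End BallDegree.

(** * Counting zeros *)

Section Compactness.

(** Heine-Borel for a property of sets that passes to subsets and finite unions; this form serves
    equally for lower bounds, maxima and finiteness. The argument takes the supremum of the [t] for
    which [a, t] has the property. *)
Lemma interval_compact (P : (R -> Prop) -> Prop) (a b : R) :
  (forall S T : R -> Prop, (forall x, S x -> T x) -> P T -> P S) ->
  (forall S T : R -> Prop, P S -> P T -> P (fun x => S x \/ T x)) ->
  (forall t, exists2 e, 0 < e & P (fun x => `|x - t| < e)) ->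
  P (fun x => a <= x <= b).
Proof.
move=> mono union loc.
have [ab|ba] := leP a b; last first.
  have [e e0 Pe] := loc a; apply: mono Pe => x /andP[ax xb]; lra.
pose E t := a <= t <= b /\ P (fun x => a <= x <= t).
have Ea : E a.
  split; first by rewrite lexx ab.
  have [e e0 Pe] := loc a; apply: mono Pe => x /andP[ax xa].
  by rewrite (_ : x = a) ?subrr ?normr0 //; apply/eqP; rewrite eq_le ax xa.
have Eb : bound E by exists b => t [/andP[_ /RleP tb] _].
have [m [mub mlub]] := completeness E Eb (ex_intro _ a Ea).
have am : a <= m by apply/RleP/mub.
have mb : m <= b by apply/RleP/mlub => t [/andP[_ /RleP tb] _].
have [e e0 Pe] := loc m.
have [t [Et tm]] : exists t, E t /\ m - e < t.
  have [//|nE] := classic (exists t, E t /\ m - e < t).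
  suff : m <= m - e by lra.
  apply/RleP/mlub => t Et; apply/RleP; rewrite leNgt; apply/negP => tm.
  by apply: nE; exists t.
have [/andP[at_ tb] Pt] := Et.
have Es s : a <= s <= b -> s < m + e -> E s.
  move=> sab sme; split=> //; apply: mono (union _ _ Pt Pe) => x /andP[ax xs].
  have [xt|tx] := leP x t; first by left; apply/andP.
  by right; rewrite ltr_norml; apply/andP; split; lra.
have mE : m = b.
  apply/eqP; rewrite eq_le mb /= leNgt; apply/negP => mltb.
  pose s := Num.min b (m + e / 2).
  have ms : m < s by rewrite /s lt_min mltb /= ltrDl; lra.
  have /mub/RleP : E s.
    apply: Es; rewrite /s ?gt_min ?ge_min ?lexx ?andbT.
      by rewrite le_min; apply/andP; split; lra.
    by apply/orP; right; lra.
  lra.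
have [] // := Es b; last lra.
by rewrite ab lexx.
Qed.

(** Tube lemma: the width [e] of a slab around x_0 = t is quantified inside the property given to
    the induction hypothesis, so a union just takes the smaller width. *)
Lemma box_compact n (P : (('I_n -> R) -> Prop) -> Prop) (L : R) :
  (forall S T : ('I_n -> R) -> Prop, (forall x, S x -> T x) -> P T -> P S) ->
  (forall S T : ('I_n -> R) -> Prop, P S -> P T -> P (fun x => S x \/ T x)) ->
  (forall y, exists2 e, 0 < e & P (fun x => forall i, `|x i - y i| < e)) ->
  P (fun x => forall i, `|x i| <= L).
Proof.
elim: n P => [|n IH] P mono union loc.
  have [e e0 Pe] := loc (fun=> 0); apply: mono Pe => x _; by case.
have slice t : exists2 e, 0 < e &
    P (fun x => `|x ord0 - t| < e /\ forall i, `|x (lift ord0 i)| <= L).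
  apply: (IH (fun S => exists2 e, 0 < e &
    P (fun x => `|x ord0 - t| < e /\ S (fun i => x (lift ord0 i))))).
  - move=> S T ST [e e0 Pe]; exists e => //; apply: mono Pe => x [xt Sx].
    by split=> //; apply: ST.
  - move=> S T [e e0 Pe] [d d0 Pd]; exists (Num.min e d).
      by rewrite lt_min e0.
    apply: mono (union _ _ Pe Pd) => x [].
    by rewrite lt_min => /andP[xe xd] [Sx|Tx]; [left|right].
  - move=> y; have [e e0 Pe] := loc (timed t y); exists e => //; exists e => //.
    apply: mono Pe => x [xt xy] i.
    by rewrite /timed; case: (unliftP ord0 i) => [j ->|->] /=; [exact: xy|].
have := @interval_compact (fun T => P (fun x =>
  T (x ord0) /\ forall i, `|x (lift ord0 i)| <= L)) (- L) L.
move=> H; apply: (mono _ _ _ (H _ _ slice)) => [x xL|S T ST|S T PS PT].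
- by split=> [|i]; [rewrite -ler_norml; exact: xL|exact: xL].
- by apply: (mono) => x [Sx xL]; split=> //; exact: ST.
- by apply: mono (union _ _ PS PT) => x [[Sx|Tx] xL]; [left|right].
Qed.

Lemma exists_pos_lower_bound (I : finType) (f : I -> R) :
  (forall i, 0 < f i) -> exists2 e, 0 < e & forall i, e <= f i.
Proof.
move=> f0; exists (\big[Num.min/1]_i f i).
  by elim/big_ind: _ => // x y x0 y0; rewrite lt_min x0.
by move=> i; rewrite (bigD1 i) //= ge_min lexx.
Qed.

Lemma exists_upper_bound (I : finType) (f : I -> R) :
  exists2 e, 0 <= e & forall i, f i <= e.
Proof.
exists (\sum_i `|f i|); first by apply: sumr_ge0.
move=> i; apply: le_trans (ler_norm _) _; rewrite (bigD1 i) //= lerDl.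
exact: sumr_ge0.
Qed.

End Compactness.

Section PolynomialBounds.
Variable n : nat.

Lemma mpoly_continuous (p : {mpoly R[n.+1]}) (y : 'I_n -> R) (eps : R) :
  0 < eps -> exists2 d, 0 < d & forall x, (forall i, `|x i - y i| < d) ->
    `|p.@[timed 0 x] - p.@[timed 0 y]| < eps.
Proof.
move=> eps0.
have [L L0 HL] := exists_upper_bound (fun i => `|timed 0 y i|).
have [C C0 HC] := meval_taylor p L.
have [D D0 HD] : exists2 D, 0 <= D &
    forall i, `|p^`M(i).@[timed 0 y]| <= D by apply: exists_upper_bound.
pose E := C + n.+1%:R * D + 1.
have E0 : 0 < E by rewrite /E ltr_wpDl // addr_ge0 // mulr_ge0.
pose d := Num.min 1 (eps / E).
have d0 : 0 < d by rewrite lt_min ltr01 divr_gt0.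
have d1 : d <= 1 by rewrite /d ge_min lexx.
have dE : d * E <= eps by rewrite -ler_pdivlMr // /d ge_min lexx orbT.
exists d => // x xy.
pose z i := timed 0 x i - timed 0 y i.
have zd i : `|z i| <= d.
  rewrite /z /timed; case: unliftP => [j _|_] /=; first exact/ltW/xy.
  by rewrite subrr normr0 ltW.
have := HC _ z d HL zd; rewrite (ltW d0) d1 => /(_ isT).
have -> : (fun i => timed 0 y i + z i) = timed 0 x.
  by apply: functional_extensionality => i; rewrite /z addrC subrK.
have : `|\sum_i z i * p^`M(i).@[timed 0 y]| <= n.+1%:R * D * d.
  apply: le_trans (ler_norm_sum _ _ _) _.
  rewrite -[X in X%:R]card_ord -mulrA mulr_natl -sumr_const; apply: ler_sum => i _.
  by rewrite normrM mulrC ler_pM.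
move: (p.@[_]) (p.@[_]) (\sum_i _) => u v w h1 h2.
have ed : (C + n.+1%:R * D) * d < eps.
  by apply: lt_le_trans dE; rewrite mulrC ltr_pM2l // /E ltrDl.
have dd : C * d ^+ 2 <= C * d by rewrite ler_wpM2l // expr2 ler_piMl // ltW.
move: h1 h2; rewrite !ler_norml ltr_norml => /andP[h1 h2] /andP[h3 h4].
apply/andP; split; lra.
Qed.

Lemma coord_lt_sqnorm (x : 'I_n -> R) (B : R) i : sqnorm x < B -> `|x i| < B + 1.
Proof.
have := sqr_le_sqnorm x i; rewrite -real_normK ?num_real //.
have := sqr_ge0 (`|x i| - 1); rewrite !expr2.
move: (`|x i|) (sqnorm x) => u s h1 h2 h3; have := sqr_ge0 u; rewrite expr2; lra.
Qed.

End PolynomialBounds.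

Section DegreeCount.
Variables (n m : nat) (G : 'I_n -> {mpoly R[n.+1]}).
Variables (c : 'I_m -> 'I_n -> R) (A : 'I_m -> 'M[R]_n).

Let field x i := (G i).@[timed 0 x].

(** Compactness: a neighbourhood of a zero is inside its ball, and near any other point some
    component of the field stays away from 0. This confines the density to small balls. *)
Lemma small_values_near_zeros (RR r : R) : 0 < r ->
  (forall x, (forall i, field x i = 0) -> exists k, x = c k) ->
  exists2 rho, 0 < rho & forall x, sqnorm x < RR ->
     sqnorm (field x) < rho -> exists k, sqdist x (c k) < r.
Proof.
move=> r0 zeros.
have [] := @box_compact n (fun S => exists2 rho, 0 < rho & forall x, S x ->
     sqnorm (field x) < rho -> exists k, sqdist x (c k) < r) (RR + 1).
- move=> S T ST [rho rho0 H]; exists rho => // x /ST; exact: H.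
- move=> S T [e e0 He] [d d0 Hd]; exists (Num.min e d); first by rewrite lt_min e0.
  move=> x STx; rewrite lt_min => /andP[xe xd].
  by case: STx => ?; [exact: He|exact: Hd].
- move=> y; have [/zeros [k yk]|ny] := classic (forall i, field y i = 0).
    have [e e0 He] := sqdist_lt_of_close n r0.
    exists e => //; exists 1 => // x xy _; exists k; rewrite -yk.
    by apply: He => i; exact/ltW/xy.
  have [i yi] : exists i, field y i != 0.
    have [//|ni] := classic (exists i, field y i != 0).
    case: ny => i; apply/eqP; rewrite -[_ == _]negbK; apply/negP => h.
    by apply: ni; exists i.
  have h0 : 0 < `|field y i| / 2 by rewrite divr_gt0 // normr_gt0.
  have [d d0 Hd] := mpoly_continuous (G i) y h0.
  exists d => //; exists ((`|field y i| / 2) ^+ 2); first by rewrite exprn_gt0.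
  move=> x /Hd xy xG; exfalso.
  have : `|field x i| ^+ 2 < (`|field y i| / 2) ^+ 2.
    apply: le_lt_trans xG; rewrite -normrX ger0_norm ?sqr_ge0 //.
    exact: sqr_le_sqnorm.
  rewrite ltr_pXn2r ?nnegrE ?normr_ge0 ?(ltW h0) // => xs.
  have := ler_distD (field x i) (field y i) 0; rewrite !subr0 (distrC (field y i)).
  move: xy xs h0; rewrite -/(field x i) -/(field y i).
  move: `|_| `|_| `|_| => u v w; lra.
move=> rho rho0 H; exists rho => // x xR; apply: H => i.
exact/ltW/coord_lt_sqnorm.
Qed.

(** A Poincare-Hopf formula: the local degrees det(A k) add up to the degree at infinity, which is 1
    because the field pairs positively with x there. *)
Lemma degree_count (c0 R0 : R) :
  (0 < n)%N -> injective c ->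
  (forall i t x, (G i).@[timed t x] = (G i).@[timed 0 x]) ->
  (forall x, (forall i, field x i = 0) -> exists k, x = c k) ->
  (forall k z, sqnorm (fun i => \sum_j A k i j * z j) = sqnorm z) ->
  (forall k, exists d e, [/\ 0 < d, 0 < e & forall x, sqdist x (c k) < d ->
     e * sqdist x (c k) <=
       \sum_i field x i * \sum_j A k i j * (x j - c k j)]) ->
  0 < c0 -> 0 < R0 -> (forall x, R0 <= sqnorm x -> c0 <= \sum_i field x i * x i) ->
  \sum_k \det (A k) = 1.
Proof.
move=> n0 cI static zeros isoA loc c00 R00 glob.
have [d Hd] := fin_all_exists loc; have {Hd} [e Hde] := fin_all_exists Hd.
have d0 k : 0 < d k by case: (Hde k).
have e0 k : 0 < e k by case: (Hde k).
have He k x : sqdist x (c k) < d k -> e k * sqdist x (c k) <=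
   \sum_i field x i * \sum_j A k i j * (x j - c k j) by case: (Hde k) => _ _; apply.
have [d1 d10 Hd1] := exists_pos_lower_bound d0.
pose sep (kl : 'I_m * 'I_m) := if kl.1 == kl.2 then 1 else sqdist (c kl.1) (c kl.2) : R.
have sep0 kl : 0 < sep kl.
  rewrite /sep; case: eqP => // kl12; rewrite lt_neqAle sqdist_ge0 andbT eq_sym.
  by apply/eqP => /sqdist_eq0/cI.
have [d2 d20 Hd2] := exists_pos_lower_bound sep0.
(* [r] fits every local pairing; 4 r <= d2 makes the balls disjoint; r <= 1 keeps them inside the
   large ball. *)
pose r := Num.min d1 (Num.min (d2 / 4) 1).
have r0 : 0 < r by rewrite !lt_min d10 ltr01 andbT divr_gt0.
have rd1 : r <= d1 by rewrite /r ge_min lexx.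
have rd2 : r <= d2 / 4 by rewrite /r !ge_min lexx orbT.
have r1 : r <= 1 by rewrite /r !ge_min lexx !orbT.
have disjoint k l (x : 'I_n -> R) : sqdist x (c k) < r -> sqdist x (c l) < r -> k = l.
  move=> xk xl; apply/eqP/negPn/negP => kl; have := Hd2 (k, l).
  rewrite /sep /= (negbTE kl); have := sqdist_triangle (c k) x (c l).
  by rewrite (sqdistC (c k) x); lra.
have [b b0 Hb] := exists_upper_bound (fun k => sqnorm (c k)).
(* RR/4 exceeds [R0], so the outer shell lies where the field is coercive, and it exceeds every |c
   k|^2 by at least 4, which leaves room for [bump_translate]. *)
pose RR := 4 * R0 + 8 * b + 16.
have RR0 : 0 < RR by rewrite /RR; lra.
have [rho1 rho10 Hrho1] := small_values_near_zeros RR r0 zeros.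
have [e1 e10 He1] := exists_pos_lower_bound e0.
(* In order: no density outside the small balls, the two bounds of [ball_degree] at each zero, the
   coercivity bound on the large ball, and the bound of [bump_translate]. *)
pose rho2 := Num.min rho1 (Num.min (r / 16) (Num.min ((e1 * r / 4) ^+ 2)
   (Num.min (c0 ^+ 2 / RR) (Num.min (1 / RR) 1)))).
have rho20 : 0 < rho2.
  by rewrite /rho2 !lt_min rho10 ltr01 !divr_gt0 ?exprn_gt0 ?divr_gt0 ?mulr_gt0.
have [Erho1 Erho2 Erho3 Erho4 Erho5] : [/\ rho2 <= rho1, rho2 <= r / 16,
   rho2 <= (e1 * r / 4) ^+ 2, rho2 <= c0 ^+ 2 / RR & rho2 <= 1 / RR].
  by rewrite /rho2 !ge_min !lexx ?orbT; split.
pose L := RR + 1.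
have L0 : 0 < L by rewrite /L; lra.
have inL (x : 'I_n -> R) : sqnorm x < RR -> forall i, `|x i| < L.
  by move=> xR i; exact: coord_lt_sqnorm.
have ball_in k (x : 'I_n -> R) : sqdist x (c k) < r -> sqnorm x < RR.
  move=> xk; have := sqdist_triangle x (c k) (fun=> 0).
  by rewrite !sqdistx0; have := Hb k; rewrite /RR; lra.
have local k := @ball_degree R n G (A k) (c k) r (e1 * r / 4) rho2 L L0 (isoA k) static r0.
have {}local k : exists C M0 : R, forall M, (0 < M)%N -> M0 <= M%:R ->
   `|lattice_sum L M (fun x =>
        degree_density G (fun y => sqdist y (c k) < r) rho2 (timed 0 x))
     - \det (A k) * lattice_sum L M (fun x : 'I_n -> R => sqpos (rho2 - sqdist x (c k)))|
     <= C * M%:R ^+ n / M%:R.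
  apply: local.
  - by rewrite divr_gt0 // mulr_gt0.
  - apply: le_trans Erho3; rewrite ler_piMr // ltW //.
  - lra.
  - by move=> x xk; apply: inL; exact: ball_in xk.
  - move=> x x1 x2; apply: le_trans (He k x _).
      by rewrite -mulrA ler_pM // ltW // divr_gt0.
    by apply: lt_le_trans x2 _; apply: le_trans (Hd1 k).
have trans k : exists C M0 : R, forall M, (0 < M)%N -> M0 <= M%:R ->
   `|lattice_sum L M (fun x : 'I_n -> R => sqpos (rho2 - sqdist x (c k)))
     - lattice_sum L M (fun x : 'I_n -> R => sqpos (rho2 - sqnorm x))|
     <= C * M%:R ^+ n / M%:R.
  apply: (@bump_translate R n (c k) RR rho2 L) => //.
  - by have := Hb k; rewrite /RR; lra.
  - by rewrite /RR; lra.
  - have : rho2 * RR <= 1 by rewrite -ler_pdivlMr.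
    have : 1 <= ((RR / 4 - sqnorm (c k)) / 2) by have := Hb k; rewrite /RR; lra.
    move: (_ / 2) => u u1; rewrite expr2; nra.
have global : exists C M0 : R, forall M, (0 < M)%N -> M0 <= M%:R ->
   `|lattice_sum L M (fun x =>
        degree_density G (fun y => sqdist y (fun=> 0) < RR) rho2 (timed 0 x))
     - \det (1%:M : 'M[R]_n) *
         lattice_sum L M (fun x : 'I_n -> R => sqpos (rho2 - sqdist x (fun=> 0)))|
     <= C * M%:R ^+ n / M%:R.
  apply: (@ball_degree R n G 1%:M (fun=> 0) RR c0 rho2 L) => //.
  - by move=> z; apply: eq_bigr => i _; rewrite sum_id_mx.
  - by rewrite -ler_pdivlMr.
  - by rewrite /RR; lra.
  - by move=> x; rewrite sqdistx0; exact: inL.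
  - move=> x; rewrite sqdistx0 => x1 _.
    rewrite (eq_bigr (fun i => field x i * x i)).
      by apply: glob; move: x1; rewrite /RR; lra.
    by move=> i _; rewrite (sum_id_mx (fun j => x j - 0)) subr0.
pose bump (x : 'I_n -> R) := sqpos (rho2 - \sum_i (G i).@[timed 0 x] ^+ 2)
   * (\det (spatial_jacobian G)).@[timed 0 x].
have densityE (B : pred ('I_n -> R)) (x : 'I_n -> R) :
    degree_density G B rho2 (timed 0 x) = if B x then bump x else 0.
  by rewrite /degree_density timedK.
(* Where |G|^2 >= rho1 the bump vanishes; elsewhere in the large ball, [x] lies in exactly one small
   ball. *)
have split_density M :
    lattice_sum L M (fun x =>
        degree_density G (fun y => sqdist y (fun=> 0) < RR) rho2 (timed 0 x)) =
    \sum_k lattice_sum L M (fun x =>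
        degree_density G (fun y => sqdist y (c k) < r) rho2 (timed 0 x)).
  rewrite /lattice_sum exchange_big; apply: eq_bigr => l _.
  move: (lattice_point L l) => x; rewrite densityE.
  rewrite (eq_bigr (fun k => if sqdist x (c k) < r then bump x else 0)); last first.
    by move=> k _; rewrite densityE.
  rewrite sqdistx0.
  have [xR|xR] := ltP; last first.
    symmetry; apply: big1 => k _; rewrite ifN // -leNgt leNgt.
    by apply/negP => /ball_in; rewrite ltNge xR.
  have [fx|fx] := ltP (sqnorm (field x)) rho1; last first.
    have -> : bump x = 0.
      by rewrite /bump sqpos_eq0 ?mul0r // subr_le0; apply: le_trans fx.
    by symmetry; apply: big1 => k _; case: ifP.
  have [k xk] := Hrho1 x xR fx.
  rewrite (bigD1 k) //= xk big1 ?addr0 // => j jk.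
  by rewrite ifN //; apply/negP => xj; rewrite (disjoint j k x xj xk) eqxx in jk.
pose W M := lattice_sum L M (fun x : 'I_n -> R => sqpos (rho2 - sqnorm x)).
pose S k M := lattice_sum L M (fun x =>
        degree_density G (fun y => sqdist y (c k) < r) rho2 (timed 0 x)).
have approx k : exists C M0 : R, forall M, (0 < M)%N -> M0 <= M%:R ->
    `|S k M - \det (A k) * W M| <= C * M%:R ^+ n / M%:R.
  have [C1 [M1 H1]] := local k; have [C2 [M2 H2]] := trans k.
  exists (C1 + `|\det (A k)| * C2), (Num.max M1 M2) => M M0.
  rewrite ge_max => /andP[/(H1 _ M0) h1 /(H2 _ M0) h2].
  move: h1 h2; rewrite -/(W M) -/(S k M).
  move: (S k M) (W M) (lattice_sum _ _ _) (\det _) => s u t dA h1 h2.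
  rewrite (_ : s - dA * u = (s - dA * t) + dA * (t - u)); last by ring.
  apply: le_trans (ler_normD _ _) _; rewrite !mulrDl lerD // normrM -!mulrA.
  by rewrite ler_wpM2l // mulrA.
have [C HC] := fin_all_exists approx; have {HC} [M0 HC] := fin_all_exists HC.
have [Cg [Mg Hg]] := global.
have [M1 M10 HM1] := exists_upper_bound M0.
pose D := \sum_k \det (A k) - 1.
have HD M : (0 < M)%N -> `|Mg| + M1 <= M%:R ->
    `|D| * W M <= (Cg + \sum_k C k) * M%:R ^+ n / M%:R.
  move=> Mp MM; have MgM : Mg <= M%:R by have := ler_norm Mg; lra.
  have := Hg M Mp MgM.
  rewrite split_density det1 mul1r.
  rewrite (_ : lattice_sum L M (fun x : 'I_n -> R => sqpos (rho2 - sqdist x (fun=> 0))) = W M);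
    last first.
    by apply: eq_bigr => l _; rewrite sqdistx0.
  have : `|\sum_k S k M - (\sum_k \det (A k)) * W M|
       <= (\sum_k C k) * (M%:R ^+ n / M%:R).
    rewrite mulr_suml -sumrB mulr_suml; apply: le_trans (ler_norm_sum _ _ _) _.
    apply: ler_sum => k _; rewrite mulrA; apply: HC => //.
    have := HM1 k; have := normr_ge0 Mg; lra.
  have W0 : 0 <= W M by apply: sumr_ge0 => l _; exact: sqpos_ge0.
  have -> : `|D| * W M = `|D * W M| by rewrite normrM (ger0_norm W0).
  rewrite /D -!mulrA.
  move: (M%:R ^+ n / M%:R) (\sum_k S k M) (\sum_k C k) (\sum_k \det _) (W M).
  move=> E s Cs dA w h1 h2.
  rewrite (_ : (dA - 1) * w = (s - w) - (s - dA * w)); last by ring.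
  by apply: le_trans (ler_normB _ _) _; rewrite mulrDl lerD.
suff : D = 0 by move/eqP; rewrite subr_eq0 => /eqP.
apply/eqP; rewrite -normr_eq0 eq_le normr_ge0 andbT leNgt; apply/negP => Dp.
(* Squeeze along M = 2 Q p: the lower bound for W(M) turns [HD] into |D| kap 2 Q p <= CC (2 Q)^n,
   which fails for p > [X]. *)
pose Q := (Num.bound (2 * n%:R * L ^+ 2 / rho2)).+1.
have HQ : 2 * n%:R * L ^+ 2 <= rho2 * Q%:R ^+ 2.
  have : 2 * n%:R * L ^+ 2 / rho2 < Q%:R.
    apply: lt_trans (archi_boundP _) _; last by rewrite ltr_nat.
    by rewrite divr_ge0 ?mulr_ge0 ?sqr_ge0 // ltW.
  rewrite ltr_pdivrMr // [ltRHS]mulrC => h; apply: ltW; apply: lt_le_trans h _.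
  by rewrite ler_wpM2l ?(ltW rho20) // expr2 ler_peMr ?ler0n // ler1n.
pose kap : R := (rho2 / 2) ^+ 2.
have kap0 : 0 < kap by rewrite exprn_gt0 // divr_gt0.
pose CC := Cg + \sum_k C k.
pose X := `|CC| * (2 * Q)%:R ^+ n / (`|D| * kap).
have X0 : 0 <= X.
  apply: divr_ge0; apply: mulr_ge0; [exact: normr_ge0| |exact: normr_ge0|exact: ltW].
  exact: exprn_ge0 (ler0n _ _).
pose Y := `|Mg| + M1.
pose p := (Num.bound X + Num.bound `|Y|).+1.
have pX : X < p%:R.
  by apply: lt_le_trans (archi_boundP X0) _; rewrite ler_nat leqW // leq_addr.
have pY : Y <= (2 * Q * p)%:R.
  apply: le_trans (ler_norm _) _; apply: ltW.
  apply: lt_le_trans (archi_boundP (normr_ge0 _)) _; rewrite ler_nat.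
  apply: (@leq_trans p); first by rewrite leqW // leq_addl.
  by rewrite leq_pmull // muln_gt0.
have Mp : (0 < 2 * Q * p)%N by rewrite !muln_gt0.
have := HD _ Mp pY.
have := @bump_lower_bound R n L rho2 Q p isT isT L0 HQ (ltW rho20).
rewrite -/(W _) -/kap => low up.
have pR : 0 < (p%:R : R) by rewrite ltr0n.
have QR : 1 <= ((2 * Q)%:R : R) by rewrite ler1n muln_gt0.
have : `|D| * (kap * p%:R ^+ n) <= CC * (2 * Q * p)%:R ^+ n / (2 * Q * p)%:R.
  by apply: le_trans up; rewrite ler_wpM2l.
rewrite (natrM _ (2 * Q)) exprMn.
clearbody p; move: ((2 * Q)%:R : R) QR @X X0 pX => q q1 X X0 pX.
have q0 : 0 < q by apply: lt_le_trans q1.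
have {X0}pX : `|CC| * q ^+ n < p%:R * (`|D| * kap) by rewrite -ltr_pdivrMr // mulr_gt0.
have pn : 0 < p%:R ^+ n :> R by rewrite exprn_gt0.
rewrite mulrA ler_pdivlMr ?mulr_gt0 // => h.
have {}h : `|D| * kap * (q * p%:R) <= CC * q ^+ n.
  by rewrite -(ler_pM2r pn) mulrAC -(mulrA CC) // mulrAC mulrA.
move: h; rewrite leNgt => /negP; apply.
apply: (@le_lt_trans _ _ (`|CC| * q ^+ n)).
  by rewrite ler_wpM2r ?ler_norm // exprn_ge0 // ltW.
apply: lt_le_trans pX _; rewrite [leLHS]mulrC ler_wpM2l //.
  by rewrite mulr_ge0 // ltW.
by rewrite ler_peMl // ltW.
Qed.

End DegreeCount.

(** * The spectral theorem *)

Section SpectralTheorem.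
Variables (n : nat) (H : 'I_n -> 'I_n -> R).
Hypothesis Hsym : forall i j, H i j = H j i.
Implicit Types x y z : 'I_n -> R.

Definition dotp x y : R := \sum_i x i * y i.
Definition apply_mx x : 'I_n -> R := fun i => \sum_j H i j * x j.

Lemma dotpC x y : dotp x y = dotp y x.
Proof. by apply: eq_bigr => i _; rewrite mulrC. Qed.

Lemma dotpDZl s x z y : dotp (fun i => x i + s * z i) y = dotp x y + s * dotp z y.
Proof. by rewrite /dotp mulr_sumr -big_split; apply: eq_bigr => i _ /=; ring. Qed.

Lemma dotpZl s x y : dotp (fun i => s * x i) y = s * dotp x y.
Proof. by rewrite /dotp mulr_sumr; apply: eq_bigr => i _; rewrite mulrA. Qed.

Lemma dotpp x : dotp x x = sqnorm x.
Proof. by apply: eq_bigr => i _; rewrite expr2. Qed.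

Lemma apply_mxDZ s x z :
  apply_mx (fun i => x i + s * z i) = fun i => apply_mx x i + s * apply_mx z i.
Proof.
apply: functional_extensionality => i; rewrite /apply_mx mulr_sumr -big_split.
by apply: eq_bigr => j _ /=; ring.
Qed.

Lemma apply_mxZ s x : apply_mx (fun i => s * x i) = fun i => s * apply_mx x i.
Proof.
apply: functional_extensionality => i; rewrite /apply_mx mulr_sumr.
by apply: eq_bigr => j _ /=; ring.
Qed.

Lemma apply_mx_sym x y : dotp (apply_mx x) y = dotp x (apply_mx y).
Proof.
rewrite /dotp /apply_mx.
transitivity (\sum_i \sum_j H i j * x j * y i).
  by apply: eq_bigr => i _; rewrite mulr_suml.
rewrite exchange_big /=; apply: eq_bigr => i _; rewrite mulr_sumr.
by apply: eq_bigr => j _; rewrite Hsym; ring.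
Qed.

Lemma exists_orthogonal k (u : 'I_k -> 'I_n -> R) : (k < n)%N ->
  exists x, sqnorm x = 1 /\ forall i, dotp (u i) x = 0.
Proof.
move=> kn; pose V : 'M[R]_(n, k) := \matrix_(i, j) u j i.
have : kermx V != 0.
  rewrite -mxrank_eq0 mxrank_ker subn_eq0 -ltnNge.
  exact: leq_ltn_trans (rank_leq_col V) kn.
move=> /rowV0Pn[v /sub_kermxP vV v0].
pose x i := v 0 i.
have sx : 0 < sqnorm x.
  rewrite lt_neqAle sqnorm_ge0 andbT eq_sym; apply/eqP => /sqnorm_eq0 x0.
  case/eqP: v0; apply/rowP => i; rewrite [RHS]mxE.
  by rewrite -/(x i) x0.
exists (fun i => (Num.sqrt (sqnorm x))^-1 * x i); split.
  rewrite -dotpp dotpZl dotpC dotpZl dotpp mulrA -expr2 exprVn sqr_sqrtr ?ltW //.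
  by rewrite mulVf // gt_eqF.
move=> i; rewrite dotpC dotpZl; apply/eqP; rewrite mulf_eq0; apply/orP; right.
have := congr1 (fun M : 'M_(1, k) => M 0 i) vV; rewrite !mxE => vi.
by apply/eqP; rewrite -[RHS]vi; apply: eq_bigr => j _; rewrite mxE.
Qed.

Let orth k (u : 'I_k -> 'I_n -> R) x := sqnorm x = 1 /\ forall i, dotp (u i) x = 0.
Let quad x := dotp (apply_mx x) x.

(** Without a maximum, each [y] meeting the constraints is beaten by some y', and by continuity so
    is a neighbourhood of [y]; points violating the constraints have neighbourhoods that violate
    them too. Compactness then yields one [y] beating every admissible point, itself included. *)
Lemma rayleigh_maximum k (u : 'I_k -> 'I_n -> R) : (k < n)%N ->
  exists y, orth u y /\ forall x, orth u x -> quad x <= quad y.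
Proof.
move=> kn.
have [//|nomax] := classic (exists y, orth u y /\ forall x, orth u x -> quad x <= quad y).
have better y : orth u y -> exists y', orth u y' /\ quad y < quad y'.
  move=> uy; have [//|nb] := classic (exists y', orth u y' /\ quad y < quad y').
  case: nomax; exists y; split=> // x ux; rewrite leNgt; apply/negP => xy.
  by apply: nb; exists x.
pose pq : {mpoly R[n.+1]} :=
  \sum_i (\sum_j (H i j)%:MP * 'X_(lift ord0 j)) * 'X_(lift ord0 i).
pose ps : {mpoly R[n.+1]} := \sum_i ('X_(lift ord0 i)) ^+ 2.
pose pd i : {mpoly R[n.+1]} := \sum_j (u i j)%:MP * 'X_(lift ord0 j).
have pqE x : pq.@[timed 0 x] = quad x.
  rewrite (raddf_sum (meval _)) /=; apply: eq_bigr => i _.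
  rewrite mevalM mevalXU timed_lift (raddf_sum (meval _)) /=; congr (_ * _).
  by apply: eq_bigr => j _; rewrite mevalM mevalC mevalXU timed_lift.
have psE x : ps.@[timed 0 x] = sqnorm x.
  rewrite (raddf_sum (meval _)) /=; apply: eq_bigr => i _.
  by rewrite rmorphXn /= mevalXU timed_lift.
have pdE i x : (pd i).@[timed 0 x] = dotp (u i) x.
  rewrite (raddf_sum (meval _)) /=; apply: eq_bigr => j _.
  by rewrite mevalM mevalC mevalXU timed_lift.
have [y0 uy0] := exists_orthogonal u kn.
have nonzero (p : {mpoly R[n.+1]}) y b : p.@[timed 0 y] <> b ->
    exists2 e, 0 < e & forall x, (forall i, `|x i - y i| < e) -> p.@[timed 0 x] <> b.
  move=> pb; have e0 : 0 < `|p.@[timed 0 y] - b|.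
    by rewrite normr_gt0 subr_eq0; apply/eqP.
  have [d d0 Hd] := mpoly_continuous p y e0; exists d => // x /Hd + xb.
  by rewrite xb distrC ltxx.
have [] := @box_compact n (fun S => exists2 y, orth u y &
     forall x, S x -> orth u x -> quad x < quad y) 1.
- by move=> S T ST [y uy Hy]; exists y => // x /ST; exact: Hy.
- move=> S T [y uy Hy] [z uz Hz]; have [yz|zy] := leP (quad y) (quad z).
    exists z => // x [Sx|Tx] ux; last exact: Hz.
    by apply: lt_le_trans yz; exact: Hy.
  exists y => // x [Sx|Tx] ux; first exact: Hy.
  by apply: lt_trans zy; exact: Hz.
- move=> y; have [uy|nuy] := classic (orth u y).
    have [y' [uy' yy']] := better y uy.
    have e0 : 0 < quad y' - quad y by rewrite subr_gt0.
    have [d d0 Hd] := mpoly_continuous pq y e0.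
    exists d => //; exists y' => // x /Hd + _.
    rewrite !pqE => /(le_lt_trans (ler_norm _)); lra.
  have [sy|sy] := eqVneq (sqnorm y) 1; last first.
    have [|e e0 He] := nonzero ps y 1; first by rewrite psE; apply/eqP.
    by exists e => //; exists y0 => // x /He; rewrite psE => + [].
  have [i yi] : exists i, dotp (u i) y <> 0.
    have [//|ni] := classic (exists i, dotp (u i) y <> 0).
    case: nuy; split=> // i; have [//|di] := classic (dotp (u i) y = 0).
    by case: ni; exists i.
  have [|e e0 He] := nonzero (pd i) y 0; first by rewrite pdE.
  by exists e => //; exists y0 => // x /He; rewrite pdE => + [_ /(_ i)].
move=> y uy Hy; suff : quad y < quad y by rewrite ltxx.
apply: Hy => // i; have := sqr_le_sqnorm y i.
by case: uy => -> _; rewrite -real_normK ?num_real // expr_le1.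
Qed.

(** Eigenvectors are produced one at a time, each maximizing the quadratic form on the unit sphere
    orthogonal to the previous ones. *)
Lemma spectral_theorem : exists (u : 'I_n -> 'I_n -> R) (lam : 'I_n -> R),
  (forall i j, dotp (u i) (u j) = (i == j)%:R) /\
  forall i, apply_mx (u i) = fun j => lam i * u i j.
Proof.
suff : forall k, (k <= n)%N -> exists (u : 'I_k -> 'I_n -> R) (lam : 'I_k -> R),
  (forall i j, dotp (u i) (u j) = (i == j)%:R) /\
  forall i, apply_mx (u i) = fun j => lam i * u i j by apply.
elim=> [_|k IH kn].
  by exists (fun=> fun=> 0), (fun=> 0); split => -[].
have [u [lam [uu Hu]]] := IH (ltnW kn).
have [y [[sy uy] ymax]] := rayleigh_maximum u kn.
pose l := quad y.
have bound w : (forall i, dotp (u i) w = 0) -> quad w <= l * sqnorm w.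
  move=> uw; have [w0|w0] := eqVneq (sqnorm w) 0.
    rewrite w0 mulr0 (sqnorm_eq0 w0) /quad dotpC.
    by rewrite /dotp big1 // => i _; rewrite mul0r.
  have sw : 0 < sqnorm w by rewrite lt_neqAle eq_sym w0 sqnorm_ge0.
  pose s := (Num.sqrt (sqnorm w))^-1.
  have ss : s * s = (sqnorm w)^-1 by rewrite -expr2 exprVn sqr_sqrtr // ltW.
  have := ymax (fun i => s * w i).
  rewrite -/l /quad apply_mxZ dotpZl dotpC dotpZl dotpC mulrA ss.
  rewrite ler_pdivrMl // mulrC; apply; split.
    by rewrite -dotpp dotpZl dotpC dotpZl dotpp mulrA ss mulVf.
  by move=> i; rewrite dotpC dotpZl dotpC uw mulr0.
(* The residual of the eigenvalue equation is orthogonal to all [u i], so it is an admissible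
   direction of variation. *)
pose w i := apply_mx y i - l * y i.
have uw i : dotp (u i) w = 0.
  have -> : w = fun i => apply_mx y i + (- l) * y i.
    by apply: functional_extensionality => j; rewrite mulNr.
  rewrite dotpC dotpDZl apply_mx_sym Hu dotpC dotpZl (dotpC y).
  by rewrite uy !mulr0 addr0.
have sl : dotp (apply_mx y) w - l * dotp y w = sqnorm w.
  by rewrite -dotpp /dotp mulr_sumr -sumrB; apply: eq_bigr => i _; rewrite /w; ring.
(* First variation of the Rayleigh quotient at [y] in the direction [w]. *)
have var s : 2 * s * sqnorm w <= s ^+ 2 * (l * sqnorm w - quad w).
  have := bound (fun i => y i + s * w i).
  have -> : sqnorm (fun i => y i + s * w i) = 1 + 2 * s * dotp y w + s ^+ 2 * sqnorm w.
    rewrite -dotpp dotpDZl (dotpC y) (dotpC w) !dotpDZl !dotpp sy (dotpC w y); ring.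
  have -> : quad (fun i => y i + s * w i) =
     l + 2 * s * dotp (apply_mx y) w + s ^+ 2 * quad w.
    rewrite /l /quad apply_mxDZ dotpDZl (dotpC (apply_mx y)) (dotpC (apply_mx w)).
    rewrite !dotpDZl -(apply_mx_sym y w) (dotpC w (apply_mx y)).
    rewrite -(apply_mx_sym y y) -(apply_mx_sym w w); ring.
  move=> h; rewrite -sl.
  have /h : forall i, dotp (u i) (fun j => y j + s * w j) = 0.
    by move=> i; rewrite dotpC dotpDZl !(dotpC _ (u i)) uy uw mulr0 addr0.
  set a := dotp (apply_mx y) w; set b := dotp y w; set q := quad w.
  rewrite (_ : sqnorm w = a - l * b) //; lra.
have w0 : sqnorm w = 0.
  apply/eqP; rewrite eq_le sqnorm_ge0 andbT leNgt; apply/negP => sw.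
  (* With s = |w|^2 / b the left side of [var] is 2 b s^2, the right side at most b s^2. *)
  pose b := `|l * sqnorm w - quad w| + 1.
  have b0 : 0 < b by rewrite ltr_wpDl.
  have hb : l * sqnorm w - quad w <= b by apply: le_trans (ler_norm _) _; rewrite lerDl.
  have := var (sqnorm w / b).
  rewrite (_ : 2 * _ * _ = 2 * b * (sqnorm w / b) ^+ 2); last by field; rewrite gt_eqF.
  have : 0 < (sqnorm w / b) ^+ 2 by rewrite exprn_gt0 // divr_gt0.
  move: (_ ^+ 2) => v v0; rewrite mulrC ler_pM2l //; lra.
have Hy : apply_mx y = fun j => l * y j.
  apply: functional_extensionality => j; apply/eqP; rewrite -subr_eq0 -/(w j).
  by rewrite (sqnorm_eq0 w0).
exists (fun i => oapp u y (unlift ord_max i)), (fun i => oapp lam l (unlift ord_max i)).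
split=> [i j|i]; last by case: (unliftP ord_max i) => [i' _|_] /=; [exact: Hu|exact: Hy].
case: (unliftP ord_max i) => [i' ->|->]; case: (unliftP ord_max j) => [j' ->|->] /=.
- by rewrite uu (inj_eq lift_inj).
- by rewrite uy eq_sym (negbTE (neq_lift _ _)).
- by rewrite dotpC uy (negbTE (neq_lift _ _)).
- by rewrite dotpp sy eqxx.
Qed.

End SpectralTheorem.

(** * Derivatives of polynomial functions *)

Section PolynomialCalculus.
Variable n : nat.
Implicit Types (p : {mpoly R[n.+1]}) (v z : 'I_n.+1 -> R) (x y : 'I_n -> R).

Lemma line_derivative p v z (t : R) :
  derivable_pt_lim (fun s => p.@[fun i => v i + s * z i]) t
    (\sum_i z i * p^`M(i).@[fun i => v i + t * z i]).
Proof.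
elim/mpoly_ring_ind: p => [c|j|p q Hp Hq|p q Hp Hq].
- rewrite big1 => [|i _]; last by rewrite mderivC meval0 mulr0.
  rewrite (_ : (fun s => _) = fct_cte c); first exact: derivable_pt_lim_const.
  by apply: functional_extensionality => s; rewrite mevalC.
- rewrite (bigD1 j) //= big1 => [|i ij]; last by rewrite mderivXU (negbTE ij) meval0 mulr0.
  rewrite mderivXU eqxx meval1 mulr1 addr0.
  rewrite (_ : (fun s => _) = (fct_cte (v j) + (mult_real_fct (z j) id))%F); last first.
    by apply: functional_extensionality => s; rewrite mevalXU mulrC.
  have := derivable_pt_lim_plus (fct_cte (v j)) (mult_real_fct (z j) id) t 0 (z j * 1)
    (derivable_pt_lim_const _ _) (derivable_pt_lim_scal _ _ _ _ (derivable_pt_lim_id t)).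
  by rewrite Rplus_0_l Rmult_1_r.
- pose fp (s : R) := p.@[fun i => v i + s * z i].
  pose fq (s : R) := q.@[fun i => v i + s * z i].
  rewrite (_ : (fun s => _) = plus_fct fp fq); last first.
    by apply: functional_extensionality => s; rewrite mevalD.
  rewrite (_ : \sum_i _ = \sum_i z i * p^`M(i).@[fun i => v i + t * z i] +
    \sum_i z i * q^`M(i).@[fun i => v i + t * z i]); first exact: derivable_pt_lim_plus.
  by rewrite -big_split; apply: eq_bigr => i _ /=; rewrite mderivD mevalD mulrDr.
- pose fp (s : R) := p.@[fun i => v i + s * z i].
  pose fq (s : R) := q.@[fun i => v i + s * z i].
  rewrite (_ : (fun s => _) = mult_fct fp fq); last first.
    by apply: functional_extensionality => s; rewrite mevalM.
  rewrite (_ : \sum_i _ = \sum_i z i * p^`M(i).@[fun i => v i + t * z i] *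
    q.@[fun i => v i + t * z i] + p.@[fun i => v i + t * z i] *
    \sum_i z i * q^`M(i).@[fun i => v i + t * z i]).
    by rewrite -mulr_suml; exact: derivable_pt_lim_mult.
  rewrite mulr_sumr -big_split; apply: eq_bigr => i _ /=.
  by rewrite mderivM mevalD !mevalM; ring.
Qed.

Lemma line_mean_value p v z : exists2 s, 0 < s < 1 &
  p.@[fun i => v i + z i] - p.@[v] = \sum_i z i * p^`M(i).@[fun i => v i + s * z i].
Proof.
pose t0 : R := 0; pose t1 : R := 1.
have [||s [+ [/RltP s0 /RltP s1]]] := @MVT_cor2 (fun s => p.@[fun i => v i + s * z i])
  (fun s => \sum_i z i * p^`M(i).@[fun i => v i + s * z i]) t0 t1.
- exact/RltP/ltr01.
- by move=> s _; exact: line_derivative.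
rewrite !RminusE RmultE subr0 mulr1 => e; exists s; first by rewrite s0.
rewrite -e; congr (_ - _); congr (_.@[_]);
  apply: functional_extensionality => i; by rewrite ?mul1r ?mul0r ?addr0.
Qed.

Lemma is_partial_meval p x k : is_partial (fun y => p.@[timed 0 y]) x k
   p^`M(lift ord0 k).@[timed 0 x].
Proof.
rewrite /is_partial.
have shiftE t : timed 0 (shift x k t) =
    fun i => timed 0 x i + t * (if i == lift ord0 k then 1 else 0).
  apply: functional_extensionality => i; rewrite /timed /shift.
  case: unliftP => [j ->|->] /=; last by rewrite mulr0 addr0.
  by rewrite (inj_eq lift_inj); case: eqP => _; rewrite ?mulr1 ?mulr0 ?addr0.
rewrite (_ : (fun t => _) = (fun t => p.@[fun i => timed 0 x i + t *
    (if i == lift ord0 k then 1 else 0)])); last first.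
  by apply: functional_extensionality => t; rewrite shiftE.
have := line_derivative p (timed 0 x) (fun i => if i == lift ord0 k then 1 else 0) 0.
rewrite (bigD1 (lift ord0 k)) //= eqxx big1 => [|i /negbTE ->]; last by rewrite mul0r.
rewrite addr0 mul1r (_ : (fun i => _ + 0 * _) = timed 0 x) //.
by apply: functional_extensionality => i; rewrite mul0r addr0.
Qed.

Lemma is_partial_unique (f : vec n -> R) x k l l' :
  is_partial f x k l -> is_partial f x k l' -> l = l'.
Proof. exact: uniqueness_limite. Qed.

(** The epsilon choice is harmless: the limit exists and is unique. *)
Lemma partial_meval p k : partial (fun y => p.@[timed 0 y]) k =
  fun x => p^`M(lift ord0 k).@[timed 0 x].
Proof.
apply: functional_extensionality => x; apply: is_partial_unique (is_partial_meval p x k).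
apply: epsilon_spec; exists p^`M(lift ord0 k).@[timed 0 x]; exact: is_partial_meval.
Qed.

Lemma hessian_meval p x k l : hessian (fun y => p.@[timed 0 y]) x k l =
  p^`M(lift ord0 k)^`M(lift ord0 l).@[timed 0 x].
Proof. by rewrite /hessian !partial_meval. Qed.

Lemma is_critical_meval p x : is_critical (fun y => p.@[timed 0 y]) x <->
  forall k, p^`M(lift ord0 k).@[timed 0 x] = 0.
Proof.
split=> H k; first exact: is_partial_unique (is_partial_meval p x k) (H k).
rewrite -[X in is_partial _ _ _ X](H k); exact: is_partial_meval.
Qed.

Lemma meval_static p : p^`M(ord0) = 0 -> forall t x, p.@[timed t x] = p.@[timed 0 x].
Proof.
move=> p0 t x.
have [s _ e] := line_mean_value p (timed 0 x) (fun i => if i == ord0 then t else 0).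
apply/eqP; rewrite -subr_eq0 -[X in _ == X](_ : \sum_i (if i == ord0 then t else 0) * 
    p^`M(i).@[fun i => timed 0 x i + s * (if i == ord0 then t else 0)] = 0); last first.
  by apply: big1 => i _; case: eqP => [->|_]; rewrite ?mul0r // p0 meval0 mulr0.
rewrite -e; apply/eqP; congr (_ - _); congr (_.@[_]); apply: functional_extensionality => i.
by rewrite /timed; case: unliftP => [j ->|->] /=; rewrite ?addr0 ?add0r.
Qed.

(** Kept as a polynomial, so that it can be applied twice with the direction held constant. *)
Definition dir_deriv x p : {mpoly R[n.+1]} := \sum_k x k *: p^`M(lift ord0 k).

Lemma dir_derivM x p q :
  dir_deriv x (p * q) = dir_deriv x p * q + p * dir_deriv x q.
Proof.
rewrite /dir_deriv mulr_suml mulr_sumr -big_split; apply: eq_bigr => k _ /=.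
by rewrite mderivM scalerDr scalerAl scalerAr.
Qed.

Lemma dir_derivD x p q : dir_deriv x (p + q) = dir_deriv x p + dir_deriv x q.
Proof.
by rewrite /dir_deriv -big_split; apply: eq_bigr => k _ /=; rewrite mderivD scalerDr.
Qed.

Lemma dir_derivC x c : dir_deriv x c%:MP = 0.
Proof. by apply: big1 => k _; rewrite mderivC scaler0. Qed.

Lemma dir_derivX x k : dir_deriv x 'X_(lift ord0 k) = (x k)%:MP.
Proof.
rewrite /dir_deriv (bigD1 k) //= big1 => [|j jk].
  by rewrite mderivXU eqxx addr0 -mul_mpolyC mulr1.
by rewrite mderivXU (inj_eq lift_inj) (negbTE jk) scaler0.
Qed.

Lemma dir_deriv_sum x (I : Type) (s : seq I) (P : pred I) (F : I -> {mpoly R[n.+1]}) :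
  dir_deriv x (\sum_(i <- s | P i) F i) = \sum_(i <- s | P i) dir_deriv x (F i).
Proof.
apply: (big_morph (dir_deriv x) (dir_derivD x)); by rewrite -mpolyC0 dir_derivC.
Qed.

Lemma dir_deriv_meval x p v :
  (dir_deriv x p).@[v] = \sum_k x k * p^`M(lift ord0 k).@[v].
Proof. by rewrite (raddf_sum (meval v)) /=; apply: eq_bigr => k _; rewrite mevalZ. Qed.

Lemma dir_deriv2_meval x p v :
  (dir_deriv x (dir_deriv x p)).@[v] =
  dotp (apply_mx (fun k l => p^`M(lift ord0 k)^`M(lift ord0 l).@[v]) x) x.
Proof.
rewrite dir_deriv_sum (raddf_sum (meval v)) /=; apply: eq_bigr => k _.
rewrite dir_deriv_meval /apply_mx mulr_suml; apply: eq_bigr => l _.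
by rewrite mderivZ mevalZ; ring.
Qed.

(** Logarithmic differentiation: P' / P is the sum of the b_j / a_j, and P'' / P = (P' / P)^2 + (P'
    / P)'. Induction on the factors avoids any logarithm. *)
Lemma dir_deriv_prod (I : Type) (s : seq I) (q : I -> {mpoly R[n.+1]}) x v :
  (forall j, (q j).@[v] != 0) ->
  let P := \prod_(j <- s) q j in
  let a j := (q j).@[v] in
  let b j := (dir_deriv x (q j)).@[v] in
  let c j := (dir_deriv x (dir_deriv x (q j))).@[v] in
  (dir_deriv x P).@[v] = P.@[v] * \sum_(j <- s) b j / a j /\
  (dir_deriv x (dir_deriv x P)).@[v] = P.@[v] *
     ((\sum_(j <- s) b j / a j) ^+ 2 + \sum_(j <- s) (c j / a j - (b j / a j) ^+ 2)).
Proof.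
move=> q0 P a b c; rewrite /P; elim: s {P} => [|j s [IH1 IH2]].
  by rewrite !big_nil -mpolyC1 dir_derivC -mpolyC0 dir_derivC mevalC; split; ring.
rewrite !big_cons !(dir_derivM, dir_derivD, mevalD, mevalM) IH1 IH2.
rewrite -/(a j) -/(b j) -/(c j).
have := q0 j; rewrite -/(a j); move: (a j) (b j) (c j) => a1 b1 c1 a10.
by split; field.
Qed.

End PolynomialCalculus.

(** * The product of squared distances *)

Section ProductOfSquares.
Variables (n r : nat) (w : 'I_r -> vec n).
Implicit Types (x v : 'I_n -> R).

Definition sqdist_poly j : {mpoly R[n.+1]} :=
  \sum_i ('X_(lift ord0 i) - (w j i)%:MP) ^+ 2.
Definition F_poly : {mpoly R[n.+1]} := \prod_j sqdist_poly j.
Definition F_grad i : {mpoly R[n.+1]} := F_poly^`M(lift ord0 i).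
Definition F_hess x (k l : 'I_n) : R :=
  F_poly^`M(lift ord0 k)^`M(lift ord0 l).@[timed 0 x].

Lemma sqdist_polyE j t x : (sqdist_poly j).@[timed t x] = sqdist x (w j).
Proof.
rewrite (raddf_sum (meval _)) /=; apply: eq_bigr => i _.
by rewrite rmorphXn /= mevalB mevalXU mevalC timed_lift.
Qed.

Lemma dir_sqdist_poly v j t x :
  (dir_deriv v (sqdist_poly j)).@[timed t x] = 2 * dotp v (fun i => x i - w j i).
Proof.
rewrite dir_deriv_sum (raddf_sum (meval _)) /= /dotp mulr_sumr; apply: eq_bigr => i _.
rewrite expr2 dir_derivM -mpolyCN dir_derivD dir_derivX dir_derivC addr0.
by rewrite mevalD !mevalM mevalD mevalXU !mevalC timed_lift; ring.
Qed.

Lemma dir2_sqdist_poly v j t x :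
  (dir_deriv v (dir_deriv v (sqdist_poly j))).@[timed t x] = 2 * sqnorm v.
Proof.
rewrite [dir_deriv v (sqdist_poly j)]dir_deriv_sum dir_deriv_sum (raddf_sum (meval _)) /= mulr_sumr.
apply: eq_bigr => i _.
have dX : dir_deriv v ('X_(lift ord0 i) - (w j i)%:MP) = (v i)%:MP.
  by rewrite -mpolyCN dir_derivD dir_derivX dir_derivC addr0.
rewrite expr2 [dir_deriv v (_ * _)]dir_derivM dX dir_derivD !dir_derivM dX dir_derivC.
by rewrite mul0r mulr0 !(addr0, add0r) mevalD !mevalM !mevalC; ring.
Qed.

Lemma Fprod_meval : Fprod w = fun x => F_poly.@[timed 0 x].
Proof.
apply: functional_extensionality => x; rewrite /Fprod (rmorph_prod (meval _)) /=.
apply: eq_bigr => j _; rewrite sqdist_polyE /enorm -[RHS]dotpp.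
have d0 : Rle 0 (dot (vsub x (w j)) (vsub x (w j))).
  by apply/RleP; rewrite [X in _ <= X]dotpp; exact: sqnorm_ge0.
by rewrite Rmult_1_r sqrt_sqrt.
Qed.

Lemma F_poly_value t x : F_poly.@[timed t x] = \prod_j sqdist x (w j).
Proof.
by rewrite (rmorph_prod (meval _)) /=; apply: eq_bigr => j _; exact: sqdist_polyE.
Qed.

Lemma F_grad_static i t x : (F_grad i).@[timed t x] = (F_grad i).@[timed 0 x].
Proof.
apply: meval_static; rewrite /F_grad mderiv_comm (_ : F_poly^`M(ord0) = 0) ?mderiv0 //.
rewrite mderiv_prod big1 // => j _.
rewrite (raddf_sum (mderiv _)) /= big1 ?mul0r // => k _.
rewrite expr2 mderivM mderivB mderivC mderivXU (negbTE (neq_lift _ _)).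
by rewrite subr0 mul0r mulr0 addr0.
Qed.

Lemma is_critical_Fprod x : is_critical (Fprod w) x <->
  forall i, (F_grad i).@[timed 0 x] = 0.
Proof. rewrite Fprod_meval; exact: is_critical_meval. Qed.

Lemma hessian_Fprod x : hessian (Fprod w) x = F_hess x.
Proof.
apply: functional_extensionality => k; apply: functional_extensionality => l.
by rewrite Fprod_meval hessian_meval.
Qed.

Lemma F_hess_sym x k l : F_hess x k l = F_hess x l k.
Proof. by rewrite /F_hess mderiv_comm. Qed.

Lemma F_grad_dir x v : (forall j, sqdist x (w j) != 0) ->
  \sum_i v i * (F_grad i).@[timed 0 x] = (\prod_j sqdist x (w j)) *
    \sum_j 2 * dotp v (fun i => x i - w j i) / sqdist x (w j).
Proof.
move=> q0; rewrite -dir_deriv_meval.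
have [|-> _] := @dir_deriv_prod n 'I_r (index_enum _) sqdist_poly v (timed 0 x).
  by move=> j; rewrite sqdist_polyE.
rewrite -/F_poly F_poly_value; congr (_ * _); apply: eq_bigr => j _.
by rewrite sqdist_polyE dir_sqdist_poly.
Qed.

(** F(x) is nonzero here, so criticality makes the logarithmic derivative vanish and the square of
    the sum in [dir_deriv_prod] drops out: the Hessians of F and log F differ only by the factor
    F(x). *)
Lemma F_hess_quad x v :
  is_critical (Fprod w) x -> (forall j, sqdist x (w j) != 0) ->
  dotp (apply_mx (F_hess x) v) v = (\prod_j sqdist x (w j)) *
    \sum_j (2 * sqnorm v / sqdist x (w j)
            - (2 * dotp v (fun i => x i - w j i) / sqdist x (w j)) ^+ 2).
Proof.
move=> /is_critical_Fprod xc q0; rewrite -dir_deriv2_meval.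
have F0 : \prod_j sqdist x (w j) != 0 by apply/prodf_neq0.
have := F_grad_dir v q0; rewrite big1 => [/esym/eqP|i _]; last by rewrite xc mulr0.
rewrite mulf_eq0 (negbTE F0) => /eqP S0.
have [|_ ->] := @dir_deriv_prod n 'I_r (index_enum _) sqdist_poly v (timed 0 x).
  by move=> j; rewrite sqdist_polyE.
rewrite -/F_poly F_poly_value; congr (_ * _).
rewrite (eq_bigr (fun j => 2 * dotp v (fun i => x i - w j i) / sqdist x (w j))).
  rewrite S0 expr0n add0r; apply: eq_bigr => j _.
  by rewrite sqdist_polyE dir_sqdist_poly dir2_sqdist_poly.
by move=> j _; rewrite sqdist_polyE dir_sqdist_poly.
Qed.

Lemma bessel v v' x : sqnorm v = 1 -> sqnorm v' = 1 -> dotp v v' = 0 ->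
  sqnorm (fun i => x i - (dotp v x * v i + dotp v' x * v' i)) =
  sqnorm x - dotp v x ^+ 2 - dotp v' x ^+ 2.
Proof.
move=> v1 v1' vv'; set b := dotp v x; set b' := dotp v' x.
rewrite {1}/sqnorm (eq_bigr (fun i => x i ^+ 2 - 2 * b * (v i * x i)
   - 2 * b' * (v' i * x i) + (b ^+ 2 * v i ^+ 2 + b' ^+ 2 * v' i ^+ 2
     + 2 * b * b' * (v i * v' i)))); last by move=> i _; ring.
rewrite !(big_split, sumrN) /= -!mulr_sumr -/(dotp v x) -/(dotp v' x) -/(dotp v v').
rewrite -/(sqnorm x) -/(sqnorm v) -/(sqnorm v') v1 v1' vv' -/b -/b'; ring.
Qed.

(* The trace of the Hessian of [log F] on a plane through [x] is a sum of
   nonnegative terms, the [j]-th of which vanishes only if the plane contains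
   [w j]. *)
Lemma F_hess_plane_trace x v v' :
  ~ in_affine_plane w -> is_critical (Fprod w) x -> (forall j, x <> w j) ->
  sqnorm v = 1 -> sqnorm v' = 1 -> dotp v v' = 0 ->
  0 < dotp (apply_mx (F_hess x) v) v + dotp (apply_mx (F_hess x) v') v'.
Proof.
move=> nplane xc xw v1 v1' vv'.
have q0 j : sqdist x (w j) != 0 by apply/eqP => /sqdist_eq0/xw.
have qp j : 0 < sqdist x (w j) by rewrite lt_neqAle eq_sym q0 sqnorm_ge0.
rewrite !F_hess_quad // v1 v1' -mulrDr mulr_gt0 ?prodr_gt0 //.
rewrite -big_split /=.
pose y j i := x i - w j i.
pose e j := sqnorm (fun i => y j i - (dotp v (y j) * v i + dotp v' (y j) * v' i)).
(* With q = |x - w j|^2 and b, b' the coordinates of x - w j along v, v', the two terms add up to 4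
   (q - b^2 - b'^2) / q^2. *)
rewrite (eq_bigr (fun j => 4 / sqdist x (w j) ^+ 2 * e j)); last first.
  move=> j _; rewrite /e bessel // -/(sqdist x (w j)).
  by move: (q0 j); rewrite -/(y j); move: (sqdist _ _) (dotp v _) (dotp v' _) => q b b' ?; field.
have t0 j : 0 <= 4 / sqdist x (w j) ^+ 2 * e j.
  by rewrite mulr_ge0 ?sqnorm_ge0 // divr_ge0 // exprn_ge0 // ltW.
rewrite lt_neqAle sumr_ge0 // andbT eq_sym; apply/eqP => s0.
apply: nplane; exists x, v, v' => j.
exists (- dotp v (y j)), (- dotp v' (y j)).
have : e j = 0.
  have /eqP := s0; rewrite psumr_eq0 // => /allP /(_ j (mem_index_enum _)) /=.
  by rewrite mulf_eq0 gt_eqF ?divr_gt0 ?exprn_gt0 //= => /eqP.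
move/sqnorm_eq0 => ej; apply: functional_extensionality => i.
have := congr1 (fun f => f i) ej; rewrite /= /y /vadd /vscale !RplusE !RmultE.
move: (dotp _ _) (dotp _ _) => b b' h; lra.
Qed.

(** The factor |x - w j|^2 and its gradient vanish at [w j], so only its second derivative 2 |v|^2
    survives, times the other factors, which are positive by injectivity. *)
Lemma F_hess_at_zero j v : injective w -> v <> (fun=> 0) ->
  0 < dotp (apply_mx (F_hess (w j)) v) v.
Proof.
move=> wI v0; rewrite -dir_deriv2_meval /F_poly (bigD1 j) //=.
set P := \prod_(i | i != j) _.
rewrite !(dir_derivM, dir_derivD, mevalD, mevalM) dir2_sqdist_poly sqdist_polyE.
rewrite dir_sqdist_poly sqdistxx.
rewrite (_ : dotp v _ = 0); last by apply: big1 => i _; rewrite subrr mulr0.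
rewrite mulr0 !mul0r !addr0 mulr_gt0 //.
  rewrite mulr_gt0 // lt_neqAle sqnorm_ge0 andbT eq_sym.
  by apply/eqP => /sqnorm_eq0.
rewrite (rmorph_prod (meval _)) prodr_gt0 // => i ij.
rewrite /= sqdist_polyE lt_neqAle sqnorm_ge0 andbT eq_sym.
by apply/eqP => /sqdist_eq0/wI e; rewrite e eqxx in ij.
Qed.

Lemma F_grad_zero j i : (F_grad i).@[timed 0 (w j)] = 0.
Proof.
rewrite /F_grad /F_poly (bigD1 j) //= mderivM mevalD !mevalM sqdist_polyE sqdistxx.
rewrite (raddf_sum (mderiv _)) (raddf_sum (meval _)) /= big1 ?mul0r ?addr0 // => k _.
by rewrite expr2 mderivM mevalD !mevalM mevalB mevalXU mevalC timed_lift subrr mulr0 mul0r addr0.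
Qed.

(** For large |x|, 1 <= |x - w j|^2 <= 4 |x|^2 and <x, x - w j> >= |x|^2 / 2. So F >= 1 and each
    term of the logarithmic derivative is at least 1/4; r > 0 provides one term. *)
Lemma F_coercive : (0 < r)%N -> exists c0 R0 : R, [/\ 0 < c0, 0 < R0 &
  forall x, R0 <= sqnorm x -> c0 <= \sum_i (F_grad i).@[timed 0 x] * x i].
Proof.
move=> r0; have [W W0 HW] := exists_upper_bound (fun j => sqnorm (w j)).
exists (1 / 4), (16 * W + 16); split=> [||x xR]; [by rewrite divr_gt0|lra|].
have y_bounds j : [/\ 1 <= sqdist x (w j), sqdist x (w j) <= 4 * sqnorm x &
    sqnorm x / 2 <= dotp x (fun i => x i - w j i)].
  have wj := HW j; have wj0 := sqnorm_ge0 (w j).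
  have h1 : sqnorm x <= 2 * sqdist x (w j) + 2 * sqnorm (w j).
    by have := sqdist_triangle x (w j) (fun=> 0); rewrite !sqdistx0.
  have h2 : sqdist x (w j) <= 2 * sqnorm x + 2 * sqnorm (w j).
    have := sqdist_triangle x (fun=> 0) (w j).
    by rewrite (sqdistC (fun=> 0)) !sqdistx0.
  have h3 : sqdist x (w j) = 2 * dotp x (fun i => x i - w j i) - sqnorm x + sqnorm (w j).
    rewrite /sqdist /sqnorm /dotp mulr_sumr -sumrB -big_split.
    by apply: eq_bigr => i _ /=; ring.
  (* Expanding this square bounds <x, w j> by |x|^2 / 8 + 2 |w j|^2. *)
  have h4 : 0 <= sqnorm (fun i => x i / 2 - 2 * w j i) := sqnorm_ge0 _.
  have h5 : sqnorm (fun i => x i / 2 - 2 * w j i) =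
     sqnorm x / 4 - 2 * (sqnorm x - dotp x (fun i => x i - w j i)) + 4 * sqnorm (w j).
    rewrite /sqnorm /dotp -sumrB !mulr_suml !mulr_sumr -sumrB -big_split.
    by apply: eq_bigr => i _ /=; field.
  split; lra.
have q0 j : sqdist x (w j) != 0.
  by have [h _ _] := y_bounds j; rewrite gt_eqF // (lt_le_trans _ h).
rewrite (eq_bigr (fun i => x i * (F_grad i).@[timed 0 x])); last first.
  by move=> i _; rewrite mulrC.
rewrite F_grad_dir //.
have F1 : 1 <= \prod_j sqdist x (w j).
  by elim/big_ind: _ => // [a b a1 b1|j _]; [nra|case: (y_bounds j)].
have S1 : 1 / 4 <= \sum_j 2 * dotp x (fun i => x i - w j i) / sqdist x (w j).
  have t j : 1 / 4 <= 2 * dotp x (fun i => x i - w j i) / sqdist x (w j).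
    have [h1 h2 h3] := y_bounds j.
    rewrite ler_pdivlMr; [lra|by apply: lt_le_trans h1].
  rewrite (bigD1 (Ordinal r0)) //=; apply: le_trans (t (Ordinal r0)) _.
  rewrite lerDl; apply: sumr_ge0 => j _.
  by apply: le_trans (t j); rewrite divr_ge0.
apply: (le_trans (S1)); rewrite ler_peMl //.
by apply: le_trans S1; rewrite divr_ge0.
Qed.

End ProductOfSquares.

(** * Eigenvalue signs and local degree *)

Section LocalDegree.
Variables (n : nat) (u : 'I_n -> 'I_n -> R).
Hypothesis uu : forall i j, dotp (u i) (u j) = (i == j)%:R.

Let U : 'M[R]_n := \matrix_(k, i) u k i.

Lemma orthonormal_mulmx : U *m U^T = 1%:M.
Proof.
apply/matrixP => i j; rewrite !mxE -uu; apply: eq_bigr => k _.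
by rewrite !mxE.
Qed.

(** For square matrices U U^T = 1 implies U^T U = 1. *)
Lemma orthonormal_complete i j : \sum_k u k i * u k j = (i == j)%:R.
Proof.
have := mulmx1C orthonormal_mulmx => /matrixP /(_ i j); rewrite !mxE => <-.
by apply: eq_bigr => k _; rewrite !mxE.
Qed.

Lemma parseval (x y : 'I_n -> R) : dotp x y = \sum_k dotp (u k) x * dotp (u k) y.
Proof.
transitivity (\sum_i \sum_j x i * y j * \sum_k u k i * u k j).
  apply: eq_bigr => i _; rewrite (bigD1 i) //= orthonormal_complete eqxx mulr1.
  rewrite big1 ?addr0 // => j ji.
  by rewrite orthonormal_complete eq_sym (negbTE ji) mulr0.
transitivity (\sum_i \sum_k \sum_j x i * y j * (u k i * u k j)).
  apply: eq_bigr => i _; rewrite exchange_big; apply: eq_bigr => j _.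
  by rewrite mulr_sumr.
rewrite exchange_big; apply: eq_bigr => k _; rewrite /dotp mulr_suml.
apply: eq_bigr => i _; rewrite mulr_sumr; apply: eq_bigr => j _; ring.
Qed.

(** The matrix U^T diag(eps) U, orthogonal when the [eps k] are signs. With the signs of the
    Hessian's eigenvalues it is the linear model to which the gradient is deformed. *)
Definition reflection_mx (eps : 'I_n -> R) : 'M[R]_n :=
  \matrix_(i, j) \sum_k eps k * (u k i * u k j).

Lemma reflection_mxE eps z i : \sum_j reflection_mx eps i j * z j =
  \sum_k eps k * dotp (u k) z * u k i.
Proof.
transitivity (\sum_j \sum_k eps k * (u k i * u k j) * z j).
  by apply: eq_bigr => j _; rewrite mxE mulr_suml.
rewrite exchange_big; apply: eq_bigr => k _; rewrite /dotp mulr_sumr mulr_suml.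
by apply: eq_bigr => j _; ring.
Qed.

Lemma dotp_reflection eps z l :
  dotp (u l) (fun i => \sum_j reflection_mx eps i j * z j) = eps l * dotp (u l) z.
Proof.
transitivity (\sum_k eps k * dotp (u k) z * dotp (u l) (u k)).
  transitivity (\sum_i \sum_k u l i * (eps k * dotp (u k) z * u k i)).
    by apply: eq_bigr => i _; rewrite reflection_mxE mulr_sumr.
  rewrite exchange_big; apply: eq_bigr => k _; rewrite [dotp (u l) _]/dotp mulr_sumr.
  by apply: eq_bigr => i _; ring.
rewrite (bigD1 l) //= uu eqxx mulr1 big1 ?addr0 // => k kl.
by rewrite uu eq_sym (negbTE kl) mulr0.
Qed.

Lemma sqnorm_reflection eps z : (forall k, eps k ^+ 2 = 1) ->
  sqnorm (fun i => \sum_j reflection_mx eps i j * z j) = sqnorm z.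
Proof.
move=> e2; rewrite -!dotpp parseval [RHS]parseval; apply: eq_bigr => k _.
rewrite dotp_reflection -[RHS]mul1r -(e2 k); ring.
Qed.

Lemma det_reflection eps : \det (reflection_mx eps) = \prod_k eps k.
Proof.
have -> : reflection_mx eps = U^T *m diag_mx (\row_k eps k) *m U.
  apply/matrixP => i j; rewrite !mxE; apply: eq_bigr => k _.
  rewrite mul_mx_diag !mxE; ring.
rewrite !det_mulmx mulrAC -det_mulmx (mulmx1C orthonormal_mulmx) det1 mul1r det_diag.
by apply: eq_bigr => k _; rewrite mxE.
Qed.

(** In the eigenbasis <H z, A z> is the sum of |lam k| <u k, z>^2, at least e |z|^2, while replacing
    [G] by its linearization costs at most D |z|^3. *)
Lemma local_pairing (G : 'I_n -> {mpoly R[n.+1]}) (a lam : 'I_n -> R) :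
  let H i j := (G i)^`M(lift ord0 j).@[timed 0 a] in
  let eps k := if lam k < 0 then -1 else 1 in
  (forall i j, H i j = H j i) ->
  (forall i, apply_mx H (u i) = fun j => lam i * u i j) ->
  (forall k, lam k != 0) -> (forall i, (G i).@[timed 0 a] = 0) ->
  exists d e, [/\ 0 < d, 0 < e & forall x, sqdist x a < d ->
    e * sqdist x a <=
      \sum_i (G i).@[timed 0 x] * \sum_j reflection_mx eps i j * (x j - a j)].
Proof.
move=> H eps Hsym Hu lam0 Ga.
have e2 k : eps k ^+ 2 = 1 by rewrite /eps; case: ifP => _; rewrite ?sqrrN expr1n.
have [e e0 He] : exists2 e, 0 < e & forall k, e <= `|lam k|.
  by apply: exists_pos_lower_bound => k; rewrite normr_gt0.
have [L L0 HL] := exists_upper_bound (fun i => `|timed 0 a i|).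
have [C HC] := fin_all_exists (fun i =>
  let: ex_intro2 c c0 hc := meval_taylor (G i) L in ex_intro _ c (conj c0 hc)).
pose D := \sum_i C i.
have D0 : 0 <= D by apply: sumr_ge0 => i _; case: (HC i).
(* For |z| <= e / (2 (D + 1)) the cubic error takes at most half of e |z|^2. *)
pose s0 := Num.min 1 (e / (2 * (D + 1))).
have D1 : 0 < 2 * (D + 1) by rewrite mulr_gt0 // ltr_wpDl.
have s00 : 0 < s0 by rewrite lt_min ltr01 divr_gt0.
exists (s0 ^+ 2), (e / 2); split; [exact: exprn_gt0|exact: divr_gt0|move=> x xa].
pose z i := x i - a i; pose s := Num.sqrt (sqnorm z).
have s2 : s ^+ 2 = sqnorm z by rewrite sqr_sqrtr // sqnorm_ge0.
have sp : 0 <= s by exact: sqrtr_ge0.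
have ss0 : s < s0.
  by rewrite -(ltr_pXn2r (_ : 0 < 2)%N) ?nnegrE ?(ltW s00) // s2.
have s1 : s <= 1 by apply: ltW; apply: lt_le_trans ss0 _; rewrite /s0 ge_min lexx.
have sD : s * (2 * (D + 1)) <= e.
  rewrite -ler_pdivlMr //; apply: ltW; apply: lt_le_trans ss0 _.
  by rewrite /s0 ge_min lexx orbT.
pose A i := \sum_j reflection_mx eps i j * z j.
have coord_le (y : 'I_n -> R) i : sqnorm y = s ^+ 2 -> `|y i| <= s.
  move=> ys; rewrite -(ler_pXn2r (_ : 0 < 2)%N) ?nnegrE // real_normK ?num_real //.
  rewrite -ys; exact: sqr_le_sqnorm.
have As i : `|A i| <= s by apply: coord_le; rewrite s2 -(sqnorm_reflection z e2).
have err i : `|(G i).@[timed 0 x] - apply_mx H z i| <= C i * s ^+ 2.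
  have [_ /(_ (timed 0 a) (timed 0 z) s HL)] := HC i.
  rewrite sp s1 => /(_ _ isT).
  rewrite (_ : (fun i0 => timed 0 a i0 + timed 0 z i0) = timed 0 x); last first.
    apply: functional_extensionality => j; rewrite /timed /z.
    by case: unliftP => [k _|_] /=; rewrite ?addr0 // addrC subrK.
  rewrite Ga subr0 big_ord_recl timed0 mul0r add0r.
  rewrite (_ : \sum_(i0 < n) _ = apply_mx H z i); last first.
    by apply: eq_bigr => j _; rewrite timed_lift mulrC.
  apply=> j; rewrite /timed; case: unliftP => [k _|_] /=; last by rewrite normr0.
  by apply: coord_le; rewrite s2.
have main : e * s ^+ 2 <= \sum_i apply_mx H z i * A i.
  rewrite -/(dotp _ _) parseval s2 -dotpp parseval mulr_sumr; apply: ler_sum => k _.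
  rewrite dotp_reflection -(apply_mx_sym Hsym) Hu dotpZl.
  have -> : lam k * dotp (u k) z * (eps k * dotp (u k) z) =
     `|lam k| * (dotp (u k) z * dotp (u k) z).
    by rewrite /eps; case: ltrP => h; [rewrite ltr0_norm|rewrite ger0_norm] => //; ring.
  by rewrite ler_wpM2r // -expr2 sqr_ge0.
have rest : - (D * s ^+ 2 * s) <=
    \sum_i ((G i).@[timed 0 x] - apply_mx H z i) * A i.
  rewrite /D !mulr_suml -sumrN; apply: ler_sum => i _.
  rewrite lerNl -mulNr; apply: le_trans (ler_norm _) _.
  by rewrite normrM normrN ler_pM.
rewrite -[sqdist x a]s2.
have -> : \sum_i (G i).@[timed 0 x] * A i =
   \sum_i apply_mx H z i * A i + \sum_i ((G i).@[timed 0 x] - apply_mx H z i) * A i.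
  by rewrite -big_split; apply: eq_bigr => i _ /=; ring.
have sq0 := sqr_ge0 s.
have : D * s ^+ 2 * s <= e / 2 * s ^+ 2.
  rewrite mulrAC ler_wpM2r //; nra.
lra.
Qed.

End LocalDegree.

Lemma finite_enumeration (T : Type) (P : T -> Prop) (l : seq T) :
  (forall x, P x -> List.In x l) ->
  exists m (c : 'I_m -> T),
    [/\ injective c, forall k, P (c k) & forall x, P x -> exists k, x = c k].
Proof.
elim: l P => [|y l IH] P Pl.
  have no (i : 'I_0) : T by case: i.
  by exists 0%N, no; split=> [[]|[]|x /Pl].
have [x [Px xy]|m [c [cI Pc cP]]] := IH (fun x => P x /\ x <> y).
  by case: (Pl x Px) => // yx; case: xy.
have [Py|nPy] := classic (P y); last first.
  exists m, c; split=> // [k|x Px]; first by case: (Pc k).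
  by apply: cP; split=> // xy; rewrite xy in Px.
exists m.+1, (fun i => oapp c y (unlift ord_max i)); split.
- move=> i j; case: unliftP => [i' ->|->]; case: unliftP => [j' ->|->] //= e.
  + by rewrite (cI _ _ e).
  + by case: (Pc i') => _; rewrite e.
  + by case: (Pc j') => _; rewrite e.
- by move=> k; case: unliftP => [k' _|_] //=; case: (Pc k').
- move=> x Px; have [->|xy] := classic (x = y).
    by exists ord_max; rewrite unlift_none.
  have [//|k ->] := cP x; by exists (lift ord_max k); rewrite liftK.
Qed.

(** * Critical points *)

Section CriticalPoints.
Variables (n r : nat) (w : 'I_r -> vec n).
Hypotheses (wI : injective w) (nplane : ~ in_affine_plane w).
Hypothesis morse : local_morse (Fprod w).

Let field x i := (F_grad w i).@[timed 0 x].

Lemma not_in_plane_r_gt0 : (0 < r)%N.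
Proof.
rewrite lt0n; apply/eqP => r0; apply: nplane.
have no (j : 'I_r) : False by case: j => j; rewrite r0.
by exists (fun=> 0), (fun=> 0), (fun=> 0) => j; case: (no j).
Qed.

Definition eigenbasis x (u : 'I_n -> 'I_n -> R) (lam : 'I_n -> R) :=
  [/\ forall i j, dotp (u i) (u j) = (i == j)%:R,
      forall i, apply_mx (F_hess w x) (u i) = fun j => lam i * u i j &
      forall i, lam i != 0].

(** A zero eigenvalue would put a unit vector in the kernel of the Hessian, against the Morse
    hypothesis. *)
Lemma critical_eigenbasis x : is_critical (Fprod w) x -> exists u lam, eigenbasis x u lam.
Proof.
move=> xc; have [u [lam [uu Hu]]] := spectral_theorem (F_hess_sym w x).
exists u, lam; split=> // i; apply/eqP => li.
have := morse xc; rewrite hessian_Fprod => /(_ (u i)) nd.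
have ui0 : u i = @zero_vec n.
  apply: nd; rewrite -[LHS]/(apply_mx (F_hess w x) (u i)) Hu li.
  by apply: functional_extensionality => j; rewrite mul0r.
have := uu i i; rewrite eqxx ui0 /dotp big1 => [|j _]; last exact: mul0r.
by move/esym/eqP; rewrite oner_eq0.
Qed.

Definition sign (a : R) : R := if a < 0 then -1 else 1.

Lemma critical_local_pairing x u lam : is_critical (Fprod w) x -> eigenbasis x u lam ->
  exists d e, [/\ 0 < d, 0 < e & forall y, sqdist y x < d ->
    e * sqdist y x <=
      \sum_i field y i * \sum_j reflection_mx u (fun k => sign (lam k)) i j * (y j - x j)].
Proof.
move=> /is_critical_Fprod xc [uu Hu lam0].
apply: (local_pairing uu (G := F_grad w)) => //.
by move=> i j; rewrite /F_grad mderiv_comm.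
Qed.

(** At a second critical point [y] the pairing of [critical_local_pairing] is 0, yet at least e |y -
    x|^2. *)
Lemma critical_isolated x : is_critical (Fprod w) x ->
  exists2 d, 0 < d & forall y, sqdist y x < d -> is_critical (Fprod w) y -> y = x.
Proof.
move=> xc; have [u [lam ul]] := critical_eigenbasis xc.
have [d [e [d0 e0 H]]] := critical_local_pairing xc ul.
exists d => // y /H + /is_critical_Fprod yc.
rewrite [X in _ <= X]big1 => [|i _]; last by rewrite /field yc mul0r.
rewrite pmulr_rle0 // => yx; apply: sqdist_eq0; apply/eqP.
by rewrite eq_le yx sqnorm_ge0.
Qed.

(** Coercivity confines the critical points to a box; each point has a neighbourhood with at most
    one, so compactness leaves finitely many. *)
Lemma finitely_many_critical :
  exists l : seq (vec n), forall x, is_critical (Fprod w) x -> List.In x l.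
Proof.
have [c0 [R0 [c00 R00 HR]]] := F_coercive w not_in_plane_r_gt0.
have bounded x : is_critical (Fprod w) x -> forall i, `|x i| <= R0 + 1.
  move=> /is_critical_Fprod xc i; apply/ltW/coord_lt_sqnorm.
  rewrite ltNge; apply/negP => /HR; rewrite big1 => [|k _]; last by rewrite xc mul0r.
  by rewrite leNgt c00.
have [] := @box_compact n (fun S => exists l : seq (vec n), forall x, S x ->
   is_critical (Fprod w) x -> List.In x l) (R0 + 1).
- by move=> S T ST [l H]; exists l => x /ST; exact: H.
- move=> S T [l Hl] [l' Hl']; exists (l ++ l') => x STx xc.
  by apply: List.in_or_app; case: STx => ?; [left; exact: Hl|right; exact: Hl'].
- move=> y; have [yc|nyc] := classic (is_critical (Fprod w) y).
    have [d d0 Hd] := critical_isolated yc.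
    have [e e0 He] := sqdist_lt_of_close n d0.
    exists e => //; exists [:: y] => x xy xc; left; symmetry; apply: Hd => //.
    by apply: He => i; exact/ltW/xy.
  have [i yi] : exists i, field y i <> 0.
    have [//|ni] := classic (exists i, field y i <> 0).
    case: nyc; apply/is_critical_Fprod => i.
    by have [//|fi] := classic (field y i = 0); case: ni; exists i.
  have y0 : 0 < `|field y i| by rewrite normr_gt0; apply/eqP.
  have [d d0 Hd] := mpoly_continuous (F_grad w i) y y0.
  exists d => //; exists [::] => x /Hd + /is_critical_Fprod xc.
  by rewrite xc sub0r normrN ltxx.
by move=> l H; exists l => x xc; apply: H (bounded x xc) xc.
Qed.

Lemma eigen_quad x u lam i : eigenbasis x u lam ->
  dotp (apply_mx (F_hess w x) (u i)) (u i) = lam i.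
Proof. by case=> uu Hu _; rewrite Hu dotpZl uu eqxx mulr1. Qed.

Lemma index_le1 x u lam : is_critical (Fprod w) x -> (forall j, x <> w j) ->
  eigenbasis x u lam -> (#|[pred i | (lam i < 0)%R]| <= 1)%N.
Proof.
move=> xc xw ul; rewrite leqNgt; apply/negP => /card_gt1P[i [j [/= i0 j0 ij]]].
rewrite !inE in i0 j0; have [uu _ _] := ul.
have := F_hess_plane_trace nplane xc xw (v := u i) (v' := u j).
rewrite -!dotpp !uu !eqxx (negbTE ij) !(eigen_quad _ ul) => /(_ erefl erefl erefl); lra.
Qed.

Lemma index_at_w j u lam : eigenbasis (w j) u lam -> #|[pred i | (lam i < 0)%R]| = 0%N.
Proof.
move=> ul; apply: eq_card0 => i; rewrite !inE; apply/negbTE; rewrite -leNgt ltW //.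
rewrite -(eigen_quad i ul); apply: F_hess_at_zero => // ui0.
have [uu _ _] := ul; have := uu i i; rewrite eqxx ui0 /dotp big1 => [|k _]; last exact: mul0r.
by move/esym/eqP; rewrite oner_eq0.
Qed.

Lemma prod_sign (lam : 'I_n -> R) :
  \prod_k sign (lam k) = (-1) ^+ #|[pred i | (lam i < 0)%R]|.
Proof. by rewrite -prodr_const [RHS]big_mkcond; apply: eq_bigr => k _; rewrite inE. Qed.

(** All signs are 1, so the reflection matrix is the identity and the local pairing reads <grad
    F(p), p - x> >= e |p - x|^2. The mean value theorem on the segment from [x] to [y] then gives
    F(y) >= F(x). *)
Lemma index0_local_min x u lam : is_critical (Fprod w) x -> eigenbasis x u lam ->
  #|[pred i | (lam i < 0)%R]| = 0%N -> local_min (Fprod w) x.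
Proof.
move=> xc ul ind0; have [uu _ _] := ul.
have [d [e [d0 e0 H]]] := critical_local_pairing xc ul.
have pos k : sign (lam k) = 1.
  by have /eqP := card0_eq ind0 k; rewrite /sign !inE => /eqP ->.
exists (Num.sqrt d); split=> [|y]; first by apply/RltP; rewrite sqrtr_gt0.
have -> : enorm (vsub y x) = Num.sqrt (sqdist y x).
  by rewrite /enorm -RsqrtE ?sqnorm_ge0 // /sqdist -dotpp.
move=> /RltP; rewrite ltr_sqrt // => yx; apply/RleP; rewrite Fprod_meval.
have [s /andP[s0 s1] e1] := line_mean_value (F_poly w) (timed 0 x) (timed 0 (fun i => y i - x i)).
rewrite (_ : (fun i => timed 0 x i + _) = timed 0 y) in e1; last first.
  apply: functional_extensionality => i; rewrite /timed.
  by case: unliftP => [j _|_] /=; rewrite ?addr0 // addrC subrK.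
rewrite -subr_ge0 e1 big_ord_recl timed0 mul0r add0r.
pose p i := x i + s * (y i - x i).
rewrite (eq_bigr (fun i => s^-1 * (field p i * (p i - x i)))); last first.
  move=> i _; rewrite timed_lift /field.
  rewrite (_ : (fun i0 => _ + s * _) = timed 0 p); last first.
    apply: functional_extensionality => j; rewrite /timed /p.
    by case: unliftP => [k _|_] //=; rewrite mulr0 addr0.
  by rewrite /F_grad /p; field; rewrite gt_eqF.
rewrite -mulr_sumr mulr_ge0 ?invr_ge0 ?(ltW s0) //.
have px : sqdist p x = s ^+ 2 * sqdist y x.
  by rewrite /sqdist /sqnorm mulr_sumr; apply: eq_bigr => i _; rewrite /p; ring.
have pd : sqdist p x < d.
  apply: le_lt_trans yx; rewrite px ler_piMl ?sqnorm_ge0 // expr_le1 // ltW //.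
apply: le_trans (_ : e * sqdist p x <= _).
  by rewrite mulr_ge0 ?sqnorm_ge0 // ltW.
apply: le_trans (H p pd) _; rewrite le_eqVlt; apply/orP; left; apply/eqP.
apply: eq_bigr => i _; congr (_ * _).
rewrite (bigD1 i) //= big1 ?addr0 => [|j ji].
  rewrite mxE (eq_bigr (fun k => u k i * u k i)).
    by rewrite (orthonormal_complete uu) eqxx mul1r.
  by move=> k _; rewrite pos mul1r.
rewrite mxE (eq_bigr (fun k => u k i * u k j)).
  by rewrite (orthonormal_complete uu) eq_sym (negbTE ji) mul0r.
by move=> k _; rewrite pos mul1r.
Qed.

Lemma eigenbasis_neg_index x u lam : eigenbasis x u lam ->
  neg_index (hessian (Fprod w) x) #|[pred i | (lam i < 0)%R]|.
Proof.
case=> uu Hu _; exists u, lam; split=> [i j|].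
  by rewrite -[LHS]/(dotp (u i) (u j)) uu; case: eqP.
split=> [i|]; first by rewrite hessian_Fprod -[LHS]/(apply_mx _ _) Hu.
apply: eq_card => i; rewrite !inE /Defs.Rltb.
case: (Rlt_dec _ _) => li; symmetry; first by apply/RltP.
by apply/negbTE/negP => /RltP.
Qed.

Lemma critical_at_w j : is_critical (Fprod w) (w j) /\ abs_min (Fprod w) (w j).
Proof.
split; first by apply/is_critical_Fprod => i; exact: F_grad_zero.
move=> y; apply/RleP; rewrite Fprod_meval !F_poly_value (bigD1 j) //=.
by rewrite sqdistxx mul0r; apply: prodr_ge0 => i _; exact: sqnorm_ge0.
Qed.

(** This is [degree_count] for grad F, the reflection with the signs of the eigenvalues having
    determinant (-1)^index. *)
Lemma critical_points_count : (0 < n)%N ->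
  exists (m : nat) (c : 'I_m -> vec n) (u : 'I_m -> 'I_n -> 'I_n -> R)
    (lam : 'I_m -> 'I_n -> R),
  [/\ injective c, forall k, is_critical (Fprod w) (c k),
      forall x, is_critical (Fprod w) x -> exists k, x = c k,
      forall k, eigenbasis (c k) (u k) (lam k) &
      \sum_k (-1) ^+ #|[pred i | (lam k i < 0)%R]| = 1 :> R].
Proof.
move=> n0; have [l Hl] := finitely_many_critical.
have [m [c [cI cc cP]]] := finite_enumeration Hl.
have [u Hu] := fin_all_exists (fun k => critical_eigenbasis (cc k)).
have {Hu}[lam Hul] := fin_all_exists Hu.
exists m, c, u, lam; split=> //.
have [c0 [R0 [c00 R00 HR]]] := F_coercive w not_in_plane_r_gt0.
pose A k := reflection_mx (u k) (fun i => sign (lam k i)).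
transitivity (\sum_k \det (A k)).
  apply: eq_bigr => k _; rewrite /A det_reflection ?prod_sign //.
  by case: (Hul k).
apply: (@degree_count n m (F_grad w) c A c0 R0) => //.
- by move=> i t x; rewrite F_grad_static.
- by move=> x x0; apply: cP; apply/is_critical_Fprod.
- move=> k z; apply: sqnorm_reflection; first by case: (Hul k).
  by move=> i; rewrite /sign; case: ifP => _; rewrite ?sqrrN expr1n.
- by move=> k; exact: critical_local_pairing (cc k) (Hul k).
Qed.

End CriticalPoints.

(** * Counting critical points by index *)

Lemma card_alternating_sum (I : finType) (ind : I -> nat) :
  (forall k, ind k <= 1)%N -> \sum_k (-1) ^+ ind k = 1 :> R ->
  #|[set k | ind k == 0%N]| = #|~: [set k | ind k == 0%N]|.+1.
Proof.
move=> ind1; set Z := [set k | _]; rewrite (bigID (mem Z)) /=.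
have -> : \sum_(k in Z) (-1) ^+ ind k = #|Z|%:R :> R.
  by rewrite -sumr_const; apply: eq_bigr => k; rewrite inE => /eqP ->.
have -> : \sum_(k | k \notin Z) (-1) ^+ ind k = - #|~: Z|%:R :> R.
  rewrite -sumr_const -sumrN; apply: eq_big => k; first by rewrite in_setC.
  rewrite inE; have := ind1 k; case: (ind k) => [|[|i]] //.
by move/eqP; rewrite subr_eq addrC natr1 eqr_nat => /eqP.
Qed.

Local Open Scope R_scope.

Theorem theorem0p2 (N r : nat) (w : 'I_r -> vec N) :
  (3 <= N)%nat ->
  (forall i j, i <> j -> w i <> w j) ->
  ~ in_affine_plane w ->
  local_morse (Fprod w) ->
  exists (h : nat) (m : 'I_h -> vec N) (s : 'I_(r + h - 1) -> vec N),
    (* the r absolute minima w_1..w_r *)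
    (forall j, is_critical (Fprod w) (w j) /\ abs_min (Fprod w) (w j)) /\
    (* h local minima off {w_1..w_r}, pairwise distinct *)
    (forall k k', m k = m k' -> k = k') /\
    (forall k, is_critical (Fprod w) (m k) /\ local_min (Fprod w) (m k) /\
               forall j, m k <> w j) /\
    (* r + h - 1 further critical points, each of negativity index 1 *)
    (forall k k', s k = s k' -> k = k') /\
    (forall k, is_critical (Fprod w) (s k) /\
               neg_index (hessian (Fprod w) (s k)) 1 /\
               (forall j, s k <> w j) /\ (forall k', s k <> m k')) /\
    (* no other critical points *)
    (forall x, is_critical (Fprod w) x ->
       (exists j, x = w j) \/ (exists k, x = m k) \/ (exists k, x = s k)).
Proof.
move=> N3 wI' nplane morse.
have wI : injective w.
  by move=> i j wij; have [//|ij] := classic (i = j); case: (wI' i j ij).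
have N0 : (0 < N)%N by apply: leq_trans N3.
have [M [c [u [lam [cI cc cP ul sum1]]]]] := critical_points_count nplane morse N0.
pose ind k := #|[pred i | (lam k i < 0)%R]|.
have [f cf] := fin_all_exists (fun j => cP (w j) (proj1 (critical_at_w w j))).
have fI : injective f by move=> i j fij; apply: wI; rewrite !cf fij.
(* [W] collects the labels of the points [w j], [Z] those of index 0; the complement [S] turns out
   to have index 1. *)
pose W := f @: setT.
pose Z := [set k | ind k == 0%N].
pose S := ~: Z.
have indW j : ind (f j) = 0%N.
  by apply: (index_at_w wI (j := j) (u := u (f j))); rewrite [w j]cf; exact: ul.
have offW k : k \notin W -> forall j, c k <> w j.
  move=> kW j ckj; case/imsetP: kW; exists j => //.
  by apply: cI; rewrite -cf.
have WZ : W \subset Z.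
  by apply/subsetP => _ /imsetP[j _ ->]; rewrite inE indW.
have ind1 k : (ind k <= 1)%N.
  have [kW|kW] := boolP (k \in W).
    by have := subsetP WZ k kW; rewrite inE => /eqP ->.
  exact: (index_le1 nplane (cc k) (offW k kW) (ul k)).
have indS k : k \in S -> ind k = 1%N.
  by rewrite !inE => kZ; apply/eqP; rewrite eqn_leq lt0n kZ ind1.
have cW : #|W| = r by rewrite card_imset // cardsT card_ord.
have ZS : #|Z| = #|S|.+1 := card_alternating_sum ind1 sum1.
pose h := #|Z :\: W|.
(* Since |Z| = r + h and |Z| = |S| + 1, the truncated subtraction is exact. *)
have cS : (r + h - 1)%N = #|S|.
  rewrite /h cardsD (setIidPr WZ) cW subnKC; last by rewrite -cW subset_leq_card.
  by rewrite ZS subn1.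
exists h, (fun k => c (enum_val k)), (fun k => c (enum_val (cast_ord cS k))).
split; first exact: critical_at_w.
split; first by move=> k k' /cI/enum_val_inj.
split.
  move=> k; have := enum_valP k; rewrite !inE => /andP[kW kZ].
  split; first exact: cc.
  split; last exact: offW.
  exact: index0_local_min (cc _) (ul _) (eqP kZ).
split; first by move=> k k' /cI/enum_val_inj/cast_ord_inj.
split.
  move=> k; have kS := enum_valP (cast_ord cS k); move: (enum_val _) kS => l lS.
  have lZ : l \notin Z by rewrite inE in lS.
  split; first exact: cc.
  split; first by rewrite -(indS l lS); exact: eigenbasis_neg_index (ul l).
  split; first by apply: offW; apply: contra lZ; exact: (subsetP WZ).
  move=> k' /cI lk; have := enum_valP k'; rewrite -lk inE => /andP[_ h1].
  by rewrite h1 in lZ.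
move=> x /cP[k ->]; have [kW|kW] := boolP (k \in W).
  by case/imsetP: kW => j _ ->; left; exists j; rewrite cf.
right; have [kZ|kZ] := boolP (k \in Z).
  have kM : k \in Z :\: W by rewrite inE kW.
  by left; exists (enum_rank_in kM k); rewrite enum_rankK_in.
have kS : k \in S by rewrite inE.
right; exists (cast_ord (esym cS) (enum_rank_in kS k)).
by rewrite cast_ordKV enum_rankK_in.
Qed.
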